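(* Let $a\ge 3$ be an odd integer with $\gcd(a,3)=1$ and $\gcd(a,5)=1$, and let $\alpha=(a-1)/2$. Let $D=[D(j,g)]$, $0\le j\le a-1$, $0\le g\le 2$, be the DM$(3;a)$ with $D(j,0)=0$, $D(j,1)=j$, $D(j,2)=\alpha j \bmod a$, and let $H$ be the parity-check matrix of Construction 1 on $D$. Then $H$ is the parity-check matrix of an $(a^2,4,a)$-regular binary QC-LDPC code (that is, the rows and columns of $H$ can be permuted so that the resulting matrix is in quasi-cyclic form) of length $a^2$, girth at least $6$, rate equal to $\displaystyle 1-\frac{4a-3}{a^2}$, and minimum distance $10$.
   Context: All rows and columns of matrices are indexed starting from $0$. Difference matrix: a DM$(3;a)$ is an $a\times 3$ array $D$ with entries in $\{0,\dots,a-1\}$ such that all entries of the first column are $0$, each other column contains each of $0,\dots,a-1$ exactly once, and for all pairs of distinct columns $j\ne j'$, $\{D(i,j)-D(i,j') \bmod a \mid 0\le i\le a-1\}=\{0,\dots,a-1\}$. The array with columns $0$, $j$, $\alpha j \bmod a$ is a DM$(3;a)$ whenever $\gcd(\alpha,a)=\gcd(\alpha-1,a)=1$. Construction 1: let $I$ be the $a\times a$ identity matrix, let $P^i$ be the $a\times a$ $(0,1)$ circulant permutation matrix whose row $r$ has its unique entry $1$ in column $r-i\bmod a$, and for $0\le v\le a-1$ let $R_v$ be the $a\times a$ matrix whose row $v$ is all ones and whose other rows are all zeros. Then $$H=\begin{bmatrix} R_0&R_1&\cdots&R_{a-1}\\ I&I&\cdots&I\\ P^{D(0,1)}&P^{D(1,1)}&\cdots&P^{D(a-1,1)}\\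 P^{D(0,2)}&P^{D(1,2)}&\cdots&P^{D(a-1,2)}\end{bmatrix},$$ a $(4a)\times a^2$ matrix. The code with a given binary parity-check matrix with $m$ columns is its null space over $\mathbb{Z}_2$; its length is $m$, its rate is (dimension over $\mathbb{Z}_2$)$/m$, and its minimum distance is the minimum Hamming weight of a non-zero codeword. $(a^2,4,a)$-regular means: $a^2$ columns, every column has $4$ ones, every row has $a$ ones. The girth is that of the Tanner graph of $H$: the bipartite graph with one vertex per row and one per column, row $i$ and column $j$ being adjacent iff $H(i,j)=1$. Quasi-cyclic form: a matrix is in quasi-cyclic form if it is a $K\times L$ array of $z\times z$ circulant matrices (each row of a block being the cyclic shift of the previous row); here $K=4$, $L=a$, $z=a$. *)

(* Defs.v *)
From mathcomp Require Import all_boot all_order all_fingroup all_algebra.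

Set Implicit Arguments.
Unset Strict Implicit.
Unset Printing Implicit Defensive.

Import Order.TTheory GRing.Theory Num.Theory.
Local Open Scope ring_scope.

(* A DM(3;a).  Differences are taken in int, so that (_ %% a)%Z is the residue
   in {0, ..., a-1}; the last clause is equality of the sets of members. *)
Definition difference_matrix (a : nat) (D : 'M[nat]_(a, 3)) : Prop :=
  [/\ forall i g, (D i g < a)%N,
      forall i, D i ord0 = 0%N,
      forall g, g != ord0 -> perm_eq [seq D i g | i : 'I_a] (iota 0 a)
    & forall g g', g != g' ->
        [seq (((D i g)%:Z - (D i g')%:Z) %% a)%Z | i : 'I_a]
          =i [seq k%:Z | k <- iota 0 a]].

Definition linear_array (a alpha : nat) : 'M[nat]_(a, 3) :=
  \matrix_(j < a, g < 3)
    match val g with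
    | 0 => 0%N
    | 1 => val j
    | _ => ((alpha * j) %% a)%N
    end.

Definition shift_mx (a i : nat) : 'M['F_2]_a :=
  \matrix_(r < a, c < a) (c%:Z == ((r%:Z - i%:Z) %% a)%Z)%:R.

Definition ones_row_mx (a : nat) (v : 'I_a) : 'M['F_2]_a :=
  \matrix_(r < a, c < a) (r == v)%:R.

(* Both sums of dimensions have constant terms: there are 4 * a rows and a ^ 2
   columns, arranged as a 4 x a array of a x a blocks. *)
Definition construction1 (a : nat) (D : 'M[nat]_(a, 3)) :
    'M['F_2]_(\sum_(k < 4) a, \sum_(i < a) a) :=
  \mxblock_(k < 4, i < a)
    match val k with
    | 0 => ones_row_mx i
    | 1 => 1%:M
    | 2 => shift_mx a (D i (inord 1))
    | _ => shift_mx a (D i (inord 2))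
    end.

Definition code m n (H : 'M['F_2]_(m, n)) : {vspace 'cV['F_2]_n} :=
  lker (linfun (mulmx H)).

Lemma mem_code m n (H : 'M['F_2]_(m, n)) (x : 'cV['F_2]_n) :
  (x \in code H) = (H *m x == 0).
Proof. by rewrite memv_ker lfunE. Qed.

Definition code_length m n (H : 'M['F_2]_(m, n)) : nat := n.

Definition rate m n (H : 'M['F_2]_(m, n)) : rat :=
  (\dim (code H))%:R / (code_length H)%:R.

Definition hamming_weight n (x : 'cV['F_2]_n) : nat :=
  #|[set i | x i ord0 != 0]|.

Definition min_distance m n (H : 'M['F_2]_(m, n)) (d : nat) : Prop :=
  (exists x, [/\ x \in code H, x != 0 & hamming_weight x = d]) /\
  (forall x, x \in code H -> x != 0 -> (d <= hamming_weight x)%N).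

Definition regular_mx m n (H : 'M['F_2]_(m, n)) (N gamma rho : nat) : Prop :=
  [/\ n = N,
      forall j, #|[set i | H i j == 1]| = gamma
    & forall i, #|[set j | H i j == 1]| = rho].

Definition tanner m n (H : 'M['F_2]_(m, n)) : rel ('I_m + 'I_n) :=
  fun u v =>
    match u, v with
    | inl i, inr j | inr j, inl i => H i j == 1
    | _, _ => false
    end.

(* The bound 2 < size c excludes the closed walks x, y, x along a single edge,
   which ucycle accepts.  An acyclic graph has infinite girth. *)
Definition girth_at_least (T : eqType) (e : rel T) (g : nat) : Prop :=
  forall c : seq T, ucycle e c -> (2 < size c)%N -> (g <= size c)%N.

(* ordS is the cyclic successor: it maps z.-1 to 0. *)
Definition circulant (R : Type) z (A : 'M[R]_z) : Prop :=
  forall r c, A (ordS r) (ordS c) = A r c.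

Definition quasi_cyclic_form (R : Type) (K L z : nat)
    (A : 'M[R]_(\sum_(k < K) z, \sum_(l < L) z)) : Prop :=
  forall (k : 'I_K) (l : 'I_L), circulant (submxblock A k l).

Definition quasi_cyclic (R : Type) (K L z : nat)
    (A : 'M[R]_(\sum_(k < K) z, \sum_(l < L) z)) : Prop :=
  exists (s : 'S_(\sum_(k < K) z)) (t : 'S_(\sum_(l < L) z)),
    quasi_cyclic_form (row_perm s (col_perm t A)).

(* Main.v *)
Require Import Defs.
From mathcomp Require Import all_boot all_order all_fingroup all_algebra.
From mathcomp Require Import ring zify.

(** The columns of [H] are the points [(x, y)] of the plane over Z/a, where [x] is
    the block of a column and [y] its position there, and the rows of [H] are the
    lines of four parallel classes: the level sets of [x], [y], [x + y] and
    [alpha * x + y].  As [2 * alpha = -1], the last class is also that of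
    [x - 2 * y].  Since 2 and 3 are units modulo [a], two lines of different
    classes meet in exactly one point ([sum_line]).

    Two points lie on at most one common line, so the Tanner graph has no 4-cycle
    ([girth6]).  The translation by [(1, 1)] acts freely on the points and on each
    class of lines, which gives the quasi-cyclic form ([quasi_cyclic_H]).  A linear
    relation between the rows has, when summed over the points of one line,
    contributions independent of that line from the three other classes; as [a] is
    odd, its coefficients are constant on each class ([left_kernel_const]), so the
    relations form a space of dimension 3 and the rank is [4 * a - 3] ([rank_H]).

    A codeword is a set of points meeting every line evenly.  An explicit set of ten
    points [word10] has this property for all [a].  The lower bound
    [even_set_card_ge10] is the core of the proof.  A nonempty even set [S] with
    fewer than ten points has at most eight.  A line with at least four points of [S] would
    force the other three classes to match these points with the remaining four,
    which leads to a set of four residues stable under incompatible shifts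
    ([fibre_card2]).  So each class pairs off the points of [S], and [S] has six or
    eight points, since each point has four distinct partners.

    With six points, two classes form a hexagon, and an alternating sum around it
    shows that each of the other two matches the antipodes ([hexagon_antipode]); but
    two classes cannot match the same points.  With eight points, two classes form
    two squares or an octagon.  Two squares are impossible ([no_square]): they would
    have a common centre, and the two other classes would impose different ratios
    between their edges.  An octagon with no square formed by the third class and
    one of the first two is impossible already for three classes
    ([octagon_conflict]), again by alternating sums around 8-cycles. *)

Set Implicit Arguments.
Unset Strict Implicit.
Unset Printing Implicit Defensive.

Import Order.TTheory GRing.Theory Num.Theory.
Local Open Scope ring_scope.

(** * Sets meeting every level set of a function evenly *)

Section EvenSets.

Variables (T : finType) (R : comUnitRingType) (S : {set T}).
Implicit Types (f g h x y : T -> R) (n : T -> T) (c d : R).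

Hypothesis unit2 : (2 : R) \is a GRing.unit.
Hypothesis unit3 : (3 : R) \is a GRing.unit.
Hypothesis unit5 : (5 : R) \is a GRing.unit.

Lemma unit_eq0 c (u : R) : c \is a GRing.unit -> c * u = 0 -> u = 0.
Proof. by move=> c_unit e; apply: (mulrI c_unit); rewrite e mulr0. Qed.

Lemma unit_eq c (u v : R) : c \is a GRing.unit -> c * (u - v) = 0 -> u = v.
Proof. by move=> c_unit /(unit_eq0 c_unit) /eqP; rewrite subr_eq0 => /eqP. Qed.

(** A function [f] stands for a parallel class of lines, its level sets; the
    level set through [p], cut down to [S], is a [fibre].  Two classes are
    separated when a line of one meets a line of the other at most once in [S],
    and a matching of [S] for [f] pairs off the points on each line, which then
    carries exactly two of them. *)
Definition fibre f p := [set q in S | f q == f p].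
Definition even_fibres f := {in S, forall p, ~~ odd #|fibre f p|}.
Definition separated f g :=
  {in S &, forall p q, f p = f q -> g p = g q -> p = q}.
Definition matching f n :=
  {in S, forall p, [/\ n p \in S, n p != p, f (n p) = f p
                     & {in S, forall q, f q = f p -> q = p \/ q = n p}]}.

Lemma even_card f : even_fibres f -> ~~ odd #|S|.
Proof.
move=> evf; have /card_partition-> := preim_partitionP f S.
elim/big_ind: _ => // [u v|_ /imsetP[p pS ->]]; first by rewrite oddD => /negPf->.
have /negPf := evf p pS; rewrite -[fibre f p]/([set q in S | f q == f p]).
by under eq_finset => q do rewrite eq_sym; move=> ->.
Qed.

(** Linear consequences are proved by exhibiting them: an equation follows from
    another one when the differences of the two sides agree, which [ring]
    decides. *)
Lemma eq_of_sub (u v w z : R) : u = v -> w - z = u - v -> w = z.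
Proof. by move=> -> /eqP; rewrite subrr subr_eq0 => /eqP. Qed.

(** Along [a], [a + s], [a + 2 * s], the only room left in a set of four for
    [a + t] is the fourth element, and then [a + s + t] has no room. *)
Lemma no_chained_shift (a b c d s t : R) :
    [/\ s <> 0, 2 * s <> 0 & t <> 0] ->
    [/\ t - s <> 0, t - 2 * s <> 0 & t + s <> 0] -> a + s = b ->
    [/\ b + s \in [:: a; b; c; d], a + t \in [:: a; b; c; d]
      & b + t \in [:: a; b; c; d]] -> False.
Proof.
move=> [s0 ss0 t0] [ts0 tss0 st0] <-{b}.
wlog ec : c d / a + s + s = c => [hw mem_abcd|].
  case: (mem_abcd); rewrite !inE => /or4P[]/eqP e mem_at mem_bt.
  - by apply/ss0/(eq_of_sub e); ring.
  - by apply/s0/(eq_of_sub e); ring.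
  - exact: (hw c d).
  - by apply: (hw d c) => //; move: mem_abcd; rewrite !inE ![(_ == c) || _]orbC.
rewrite -{c}ec => -[_]; rewrite !inE => /or4P[]/eqP e.
- by case: t0; apply: (eq_of_sub e); ring.
- by case: ts0; apply: (eq_of_sub e); ring.
- by case: tss0; apply: (eq_of_sub e); ring.
rewrite -{d}e => /or4P[]/eqP e.
- by apply/st0/(eq_of_sub e); ring.
- by apply/t0/(eq_of_sub e); ring.
- by apply/ts0/(eq_of_sub e); ring.
- by apply/s0/(eq_of_sub e); ring.
Qed.

(** If the shifts by [2 * e] and by [- e] both keep [u1] and [u2] inside
    [{u1, u2, v1, v2}], then by the previous lemma neither shift can lead from one
    of [u1], [u2] to the other.  Both pairs of shifts then fill [{v1, v2}], so
    [u2 + 2 * e = u1 - e] and [u1 + 2 * e = u2 - e], hence [6 * e = 0]. *)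
Lemma two_shifts_escape (u1 u2 v1 v2 e : R) :
    u1 <> u2 -> e <> 0 ->
    {in [:: u1; u2], forall u, u + 2 * e \in [:: u1; u2; v1; v2] /\
                               u - e \in [:: u1; u2; v1; v2]} ->
  False.
Proof.
move=> neu e0.
have ke k (u : R) : k \is a GRing.unit -> u = k * e -> u <> 0.
  by move=> k_unit -> /(unit_eq0 k_unit).
have unit4 : (4 : R) \is a GRing.unit by rewrite (natrM R 2 2) unitrM unit2.
have unit6 : (6 : R) \is a GRing.unit by rewrite (natrM R 2 3) unitrM unit2.
have unitN (k : R) : k \is a GRing.unit -> - k \is a GRing.unit by rewrite unitrN.
have unit1 := unitr1 R.
have off a b : {in [:: a; b], forall u, u + 2 * e \in [:: a; b; v1; v2] /\
                                        u - e \in [:: a; b; v1; v2]} ->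
    (a + 2 * e \in [:: v1; v2]) /\ (a - e \in [:: v1; v2]).
  move=> sub; have [a2 aN1] := sub a (mem_head _ _).
  have [b2 bN1] := sub b (mem_last _ [:: b]).
  have step2 : a + 2 * e <> b.
    move=> eb; apply: (@no_chained_shift a b v1 v2 (2 * e) (- e)) => //.
    - by split; [apply: (ke 2) | apply: (ke 4) | apply: (ke (-1))]; auto; ring.
    - by split; [apply: (ke (-3)) | apply: (ke (-5)) | apply: (ke 1)]; auto; ring.
  have stepN1 : a - e <> b.
    move=> eb; apply: (@no_chained_shift a b v1 v2 (- e) (2 * e)) => //.
    - by split; [apply: (ke (-1)) | apply: (ke (-2)) | apply: (ke 2)]; auto; ring.
    - by split; [apply: (ke 3) | apply: (ke 4) | apply: (ke 1)]; auto; ring.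
  split.
    move: a2; rewrite in_cons => /orP[/eqP ee|].
      by case: (ke 2 (2 * e)) => //; apply: (eq_of_sub ee); ring.
    by rewrite in_cons => /orP[/eqP|].
  move: aN1; rewrite in_cons => /orP[/eqP ee|].
    by case: (ke 1 e); rewrite ?mul1r //; apply/esym/(eq_of_sub ee); ring.
  by rewrite in_cons => /orP[/eqP|].
move=> sub; have [] := off u1 u2 sub; have [|] := off u2 u1.
  move=> u; rewrite !inE orbC => uu; have := sub u; rewrite !inE => /(_ uu)[].
  by split; rewrite orbCA.
have nee u : u + 2 * e = u - e -> False.
  by move=> ee; apply: (ke 3 (3 * e)) => //; apply: (eq_of_sub ee); ring.
rewrite !inE => /orP[]/eqP e1 /orP[]/eqP e2 /orP[]/eqP e3 /orP[]/eqP e4.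
all: try by apply: (nee u1); rewrite e3 e4.
all: try by apply: (nee u2); rewrite e1 e2.
all: try by apply: neu; apply: (addIr (2 * e)); rewrite e3 e1.
all: apply: (ke 6 (6 * e)) => //.
all: by apply: (@eq_of_sub (u2 + 2 * e + (u1 + 2 * e)) (u1 - e + (u2 - e)));
  [rewrite e1 e2 e3 e4 | ring].
Qed.

(** The default value only matters on lines that meet [S] once. *)
Definition partner f p := odflt p [pick q in S | (q != p) && (f q == f p)].

Lemma partnerP f p : even_fibres f -> p \in S ->
  [/\ partner f p \in S, partner f p != p & f (partner f p) = f p].
Proof.
move=> evf pS; rewrite /partner; case: pickP => [q /and3P[qS qp /eqP]|no] //=.
have := evf p pS; suff -> : fibre f p = [set p] by rewrite cards1.
apply/setP=> q; rewrite !inE; have := no q; case: eqVneq => [->|_] /=.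
  by rewrite pS eqxx.
by [].
Qed.

Lemma partner_matching f : {in S, forall p, #|fibre f p| = 2%N} ->
  even_fibres f /\ matching f (partner f).
Proof.
move=> card2; have evf : even_fibres f by move=> p /card2->.
split=> // p pS; have [nS np fn] := partnerP evf pS; split=> // q qS fq.
have /eqP : [set p; partner f p] == fibre f p.
  rewrite eqEcard card2 // cards2 eq_sym np andbT.
  by apply/subsetP=> r; rewrite !inE => /orP[]/eqP->; rewrite ?pS ?nS ?fn eqxx.
by move/setP/(_ q); rewrite !inE qS fq eqxx => /orP[]/eqP; [left | right].
Qed.

(** Every line carries exactly two points of a small even set.  A line with at
    least four points [B] forces three further points for each of them, one on
    every line of the other classes, so [B] and its complement [Q] have four
    points each and each of the other classes matches [B] with [Q].  Hence
    [h0] takes the same four values on [B] and [Q], and comparing [h0] with [h1]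
    and with [h2] shows that these values are stable under the shifts by [2 * e]
    and [- e], where [e] is the difference between the values of [g] on [B] and on
    a line meeting [Q]; two points of [Q] on such a line contradict
    [two_shifts_escape].

    The shape [h1 = h0 + 2 * g], [h2 = h0 - g] fits every one of the four
    classes once the functions are rescaled: the cross-ratio of the four
    directions is preserved by the double transpositions. *)
Lemma fibre_card2 g h0 h1 h2 :
    (forall p, h1 p = h0 p + 2 * g p) -> (forall p, h2 p = h0 p - g p) ->
    separated g h0 ->
    [/\ even_fibres g, even_fibres h0, even_fibres h1 & even_fibres h2] ->
    (#|S| <= 8)%N ->
  {in S, forall p, #|fibre g p| = 2%N}.
Proof.
move=> h1E h2E sep0 [evg ev0 ev1 ev2] cardS p pS.
have sep1 : separated g h1.
  move=> a b aS bS gab; rewrite !h1E gab => /addIr; exact: sep0.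
have sep2 : separated g h2.
  move=> a b aS bS gab; rewrite !h2E gab => /addIr; exact: sep0.
have sep01 : separated h0 h1.
  move=> a b aS bS hab; rewrite !h1E hab => /addrI/(mulrI unit2) gab.
  exact: sep0.
have sep02 : separated h0 h2.
  by move=> a b aS bS hab; rewrite !h2E hab => /addrI/oppr_inj gab; apply: sep0.
have sep12 : separated h1 h2.
  move=> a b aS bS e1 e2; apply: sep1 => //; apply: (unit_eq unit3).
  have e12 : h1 a - h2 a = h1 b - h2 b by rewrite e1 e2.
  by apply: (eq_of_sub e12); rewrite !h1E !h2E; ring.
pose B := fibre g p; pose Q := S :\: B.
have subB b : b \in B -> b \in S /\ g b = g p by rewrite inE => /andP[? /eqP].
have BS : B \subset S by apply/subsetP=> b /subB[].
have QE q : (q \in Q) = (q \in S) && (g q != g p).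
  by rewrite !inE; case: (q \in S); rewrite ?andbF // andbT.
have cardBQ : (#|B| + #|Q| = #|S|)%N by rewrite cardsD (setIidPr BS) subnKC ?subset_leq_card.
clearbody Q.
have pB : p \in B by rewrite inE pS /=.
have B_gt0 : (0 < #|B|)%N by apply/card_gt0P; exists p.
have evB : ~~ odd #|B| := evg p pS; have evS := even_card evg.
have evQ : ~~ odd #|Q| by move: evS; rewrite -cardBQ oddD (negPf evB).
have [B_le3 | B_gt3] := leqP #|B| 3.
  by move: B_gt0 B_le3 evB; rewrite -/B; case: #|B| => [|[|[|[|]]]].
have toQ h b : separated g h -> even_fibres h -> b \in B -> partner h b \in Q.
  move=> sep evh /subB[bS gb]; have [nS nb hn] := partnerP evh bS.
  rewrite QE nS -gb; apply: contraNneq nb => gn.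
  by apply/eqP; apply: sep.
have sepn h h' b : even_fibres h -> even_fibres h' -> separated h h' -> b \in B ->
    partner h b != partner h' b.
  move=> evh evh' sep /subB[bS _].
  have [nS nb hn] := partnerP evh bS; have [_ _ hn'] := partnerP evh' bS.
  apply: contraNneq nb => nn; apply/eqP; apply: sep => //.
  by rewrite nn.
have Q_gt2 : (2 < #|Q|)%N.
  have uniq3 : uniq [:: partner h0 p; partner h1 p; partner h2 p].
    by rewrite /= !inE negb_or !sepn.
  have /= card3 := card_uniqP uniq3.
  apply: (leq_trans (eq_leq (esym card3))); apply/subset_leq_card/subsetP=> q.
  by rewrite !inE => /or3P[]/eqP->; rewrite toQ.
have [cardB cardQ] : #|B| = 4%N /\ #|Q| = 4%N.
  move: evQ; have : (#|B| + #|Q| <= 8)%N by rewrite cardBQ.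
  by lia.
have onto h : separated g h -> even_fibres h ->
    {in Q, forall q, exists2 b, b \in B & h q = h b} /\
    {in B, forall b, exists2 q, q \in Q & h b = h q}.
  move=> sep evh; have nfix b : b \in B -> h (partner h b) = h b.
    by move=> /subB[bS _]; have [] := partnerP evh bS.
  have /eqP imQ : partner h @: B == Q.
    rewrite eqEcard card_in_imset ?cardB ?cardQ ?leqnn ?andbT.
      by apply/subsetP=> _ /imsetP[b bB ->]; apply: toQ.
    move=> b b' bB b'B nn; have [[bS gb] [b'S gb']] := (subB _ bB, subB _ b'B).
    by apply: sep => //; [rewrite gb | rewrite -nfix // nn nfix].
  split=> [q|b bB]; first by rewrite -imQ => /imsetP[b bB ->]; exists b; rewrite ?nfix.
  by exists (partner h b); rewrite ?nfix ?toQ.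
have [onto0 onto0'] := onto h0 sep0 ev0.
have [onto1 _] := onto h1 sep1 ev1; have [onto2 _] := onto h2 sep2 ev2.
have u1Q : partner h0 p \in Q by apply: toQ.
move: (partner h0 p) u1Q => u1 u1Q; have := u1Q; rewrite QE => /andP[u1S gu1].
have [u2S u21 gu2] := partnerP evg u1S; set u2 := partner g u1 in u2S u21 gu2.
have u2Q : u2 \in Q by rewrite QE u2S gu2.
have /cards2P[v1 [v2 [_ Qv]]] : #|Q :\ u1 :\ u2| == 2%N.
  by move: cardQ; rewrite (cardsD1 u1) u1Q (cardsD1 u2 (Q :\ u1)) !inE u21 u2Q !add1n => -[->].
have QY q : q \in Q -> h0 q \in [:: h0 u1; h0 u2; h0 v1; h0 v2].
  move=> qQ; have := in_setD1 q (Q :\ u1) u2; rewrite Qv in_set2 in_setD1 qQ andbT !inE.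
  case: (eqVneq q u1) => [->|_]; first by rewrite eqxx.
  case: (eqVneq q u2) => [->|_]; first by rewrite eqxx orbT.
  by case/orP => /eqP->; rewrite eqxx !orbT.
exfalso; apply: (@two_shifts_escape (h0 u1) (h0 u2) (h0 v1) (h0 v2) (g u1 - g p)).
- by move/(sep0 _ _ u1S u2S (esym gu2))/eqP; rewrite eq_sym (negPf u21).
- by move/eqP; rewrite subr_eq0 (negPf gu1).
have main u : u \in Q -> g u = g u1 ->
    h0 u + 2 * (g u1 - g p) \in [:: h0 u1; h0 u2; h0 v1; h0 v2] /\
    h0 u - (g u1 - g p) \in [:: h0 u1; h0 u2; h0 v1; h0 v2].
  move=> uQ gu; split.
    have [b bB] := onto1 u uQ; rewrite !h1E gu (subB b bB).2 => e.
    have -> : h0 u + 2 * (g u1 - g p) = h0 b by apply: (eq_of_sub e); ring.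
    by have [q qQ ->] := onto0' b bB; apply: QY.
  have [b bB] := onto2 u uQ; rewrite !h2E gu (subB b bB).2 => e.
  have -> : h0 u - (g u1 - g p) = h0 b by apply: (eq_of_sub e); ring.
  by have [q qQ ->] := onto0' b bB; apply: QY.
move=> z z12; have /orP[/eqP->|/eqP->] : (z == h0 u1) || (z == h0 u2).
- by move: z12; rewrite !inE.
- exact: main.
- exact: main.
Qed.

End EvenSets.

Local Open Scope nat_scope.

(** * Matchings of six or eight labelled points *)

Section IndexMatchings.

Variable R : comUnitRingType.
Hypothesis unit2 : (2 : R)%R \is a GRing.unit.
Implicit Types (v x y f : nat -> R) (a b m : nat -> nat) (c d : R).

(** A matching of points labelled by [0, ..., k - 1], where [v] gives the values of
    a function at these points.  Labels make the configurations of a few points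
    a finite enumeration. *)
Definition index_matching k v m :=
  forall i, i < k -> [/\ m i < k, m i <> i, m (m i) = i, v (m i) = v i
    & forall j, j < k -> v j = v i -> j = i \/ j = m i].

Definition disjoint_matchings k a m := forall i, i < k -> m i <> a i.

Lemma lt6_cases i : i < 6 ->
  [\/ i = 0, i = 1 | i = 2] \/ [\/ i = 3, i = 4 | i = 5].
Proof.
by case: i => [|[|[|[|[|[|]]]]]] // _; [left|left|left|right|right|right]; constructor.
Qed.

Lemma lt8_cases i : i < 8 ->
  [\/ i = 0, i = 1, i = 2 | i = 3] \/ [\/ i = 4, i = 5, i = 6 | i = 7].
Proof.
by case: i => [|[|[|[|[|[|[|[|]]]]]]]] // _;
  [left|left|left|left|right|right|right|right]; constructor.
Qed.

Lemma index_matching_val k v m i : index_matching k v m -> i < k -> v (m i) = v i.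
Proof. by move=> vm ltik; have [] := vm i ltik. Qed.

Lemma index_matching_lt k v m i : index_matching k v m -> i < k -> m i < k.
Proof. by move=> vm ltik; have [] := vm i ltik. Qed.

Lemma index_matching_exact k v m i j : index_matching k v m ->
  i < k -> j < k -> v j = v i -> j = i \/ j = m i.
Proof. by move=> vm ltik ltjk; have [_ _ _ _] := vm i ltik; apply. Qed.

Lemma index_matching_exact2 k v m i j : index_matching k v m ->
  i < k -> j < k -> (2 * (v j - v i) = 0)%R -> j = i \/ j = m i.
Proof.
by move=> vm ltik ltjk /(unit_eq unit2); apply: index_matching_exact vm ltik ltjk.
Qed.

Lemma chord_facts k v a b m i : index_matching k v m ->
  disjoint_matchings k a m -> disjoint_matchings k b m -> i < k ->
  m i < k /\ [/\ m i <> i, m (m i) = i, m i <> a i & m i <> b i].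
Proof.
move=> vm am bm ltik; have [ltm nm mK _ _] := vm i ltik.
by split=> //; split=> //; [apply: am | apply: bm].
Qed.

Lemma index_matching_scale k c v w m : c \is a GRing.unit ->
  (forall i, w i = c * v i)%R -> index_matching k v m -> index_matching k w m.
Proof.
move=> c_unit wE vm i /vm[? ? ? vmi ex]; split=> // [|j ltj]; first by rewrite !wE vmi.
by rewrite !wE => /(mulrI c_unit); apply: ex.
Qed.

(* Discards a partial assignment of the chords that breaks the involution, a
   disjointness or a forbidden 4-cycle. *)
Ltac prune := try (exfalso; congruence).

(* Refutes the goal from an equation [e] forcing equal values at the labels
   [i] and [j], which are not matched to each other. *)
Ltac close_by e sep i j :=
  case: (sep i j isT isT); [by apply: (eq_of_sub (esym e)); ring | congruence | congruence].

(** The alternating sum of [x + y] around the hexagon vanishes.  If a chord of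
    the third matching joined two even labels, another one would join two odd
    labels; the remaining chord would cancel and the values at these two chords
    would agree, putting four points on one line.  So every chord joins labels of
    opposite parity, hence antipodes. *)
Lemma hexagon_antipode x y f a b m :
    map a (iota 0 6) = [:: 1; 0; 3; 2; 5; 4] ->
    map b (iota 0 6) = [:: 5; 2; 1; 4; 3; 0] ->
    index_matching 6 x a -> index_matching 6 y b ->
    (forall i, f i = x i + y i)%R -> index_matching 6 f m ->
    disjoint_matchings 6 a m -> disjoint_matchings 6 b m ->
  m 0 = 3.
Proof.
case=> a0 a1 a2 a3 a4 a5 [b0 b1 b2 b3 b4 b5] xa yb fE fm am bm.
have alt : (f 0%N + f 2%N + f 4%N = f 1%N + f 3%N + f 5%N)%R.
  have xaE i (lti : i < 6) := index_matching_val xa lti.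
  have ybE i (lti : i < 6) := index_matching_val yb lti.
  have := (xaE 0 isT, xaE 2 isT, xaE 4 isT); rewrite a0 a2 a4 => -[[x0 x2] x4].
  have := (ybE 1 isT, ybE 3 isT, ybE 5 isT); rewrite b1 b3 b5 => -[[y1 y3] y5].
  by rewrite !fE x0 x2 x4 y1 y3 y5; ring.
have fmE i (lti : i < 6) := index_matching_val fm lti.
have f0 := fmE 0 isT; have f1 := fmE 1 isT; have f2 := fmE 2 isT.
have f3 := fmE 3 isT; have f4 := fmE 4 isT; have f5 := fmE 5 isT.
have [lt0 [? ? ? ?]] := chord_facts fm am bm (isT : 0 < 6).
have [lt1 [? ? ? ?]] := chord_facts fm am bm (isT : 1 < 6).
have [lt2 [? ? ? ?]] := chord_facts fm am bm (isT : 2 < 6).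
have [lt3 [? ? ? ?]] := chord_facts fm am bm (isT : 3 < 6).
have [lt4 [? ? ? ?]] := chord_facts fm am bm (isT : 4 < 6).
have [lt5 [? ? ? ?]] := chord_facts fm am bm (isT : 5 < 6).
clear xa yb fE fmE.
case: (lt6_cases lt0) => -[] E0; prune.
all: case: (lt6_cases lt1) => -[] E1; prune.
all: case: (lt6_cases lt2) => -[] E2; prune.
all: case: (lt6_cases lt3) => -[] E3; prune.
all: case: (lt6_cases lt4) => -[] E4; prune.
all: case: (lt6_cases lt5) => -[] E5; prune.
all: rewrite ?(E0, E1, E2, E3, E4, E5) in f0 f1 f2 f3 f4 f5.
all: try done.
all: exfalso; have fsep := fun i j => @index_matching_exact2 6 f m i j fm.
all: rewrite ?f5 ?f4 ?f3 ?f2 ?f1 ?f0 in alt.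
all: first [close_by alt fsep 0 1 | close_by alt fsep 0 3].
Qed.

(** Again the alternating sum of [f] around the octagon vanishes, which excludes
    a single chord between even labels.  With none, or with all chords inside the
    two parities, a chord of [m] is parallel to another one along an edge, and the
    two edges and chords form a 4-cycle, except in four cases.  In these four the
    octagon of [a] and [m] is the one with a single even chord, which is an edge
    of [b]; [alt15] and [alt37] are its alternating sums. *)
Lemma octagon_conflict x y f a b m :
    map a (iota 0 8) = [:: 1; 0; 3; 2; 5; 4; 7; 6] ->
    map b (iota 0 8) = [:: 7; 2; 1; 4; 3; 6; 5; 0] ->
    index_matching 8 x a -> index_matching 8 y b ->
    (forall i, f i = x i + y i)%R -> index_matching 8 f m ->
    disjoint_matchings 8 a m -> disjoint_matchings 8 b m ->
    (forall i, i < 8 -> m (a i) <> a (m i)) ->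
    (forall i, i < 8 -> m (b i) <> b (m i)) ->
  False.
Proof.
case=> a0 a1 a2 a3 a4 a5 a6 a7 [b0 b1 b2 b3 b4 b5 b6 b7] xa yb fE fm am bm sqa sqb.
have xaE i (lti : i < 8) := index_matching_val xa lti.
have ybE i (lti : i < 8) := index_matching_val yb lti.
have := (xaE 0 isT, xaE 2 isT, xaE 4 isT, xaE 6 isT).
rewrite a0 a2 a4 a6 => -[[[x0 x2] x4] x6].
have := (ybE 1 isT, ybE 3 isT, ybE 5 isT, ybE 7 isT).
rewrite b1 b3 b5 b7 => -[[[y1 y3] y5] y7].
have alt : (f 0%N + f 2%N + f 4%N + f 6%N = f 1%N + f 3%N + f 5%N + f 7%N)%R.
  by rewrite !fE x0 x2 x4 x6 y1 y3 y5 -y7; ring.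
have alt15 : (f 0%N + f 3%N + f 5%N + f 6%N - (f 1%N + f 2%N + f 4%N + f 7%N)
              = 2 * (y 5%N - y 1%N))%R.
  by rewrite !fE x0 x2 x4 x6 y1 y3 y5 -y7; ring.
have alt37 : (f 0%N + f 2%N + f 5%N + f 7%N - (f 1%N + f 3%N + f 4%N + f 6%N)
              = 2 * (y 7%N - y 3%N))%R.
  by rewrite !fE x0 x2 x4 x6 y1 y3 y5 -y7; ring.
have fmE i (lti : i < 8) := index_matching_val fm lti.
have f0 := fmE 0 isT; have f1 := fmE 1 isT; have f2 := fmE 2 isT; have f3 := fmE 3 isT.
have f4 := fmE 4 isT; have f5 := fmE 5 isT; have f6 := fmE 6 isT; have f7 := fmE 7 isT.
have [lt0 [? ? ? ?]] := chord_facts fm am bm (isT : 0 < 8).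
have [lt1 [? ? ? ?]] := chord_facts fm am bm (isT : 1 < 8).
have [lt2 [? ? ? ?]] := chord_facts fm am bm (isT : 2 < 8).
have [lt3 [? ? ? ?]] := chord_facts fm am bm (isT : 3 < 8).
have [lt4 [? ? ? ?]] := chord_facts fm am bm (isT : 4 < 8).
have [lt5 [? ? ? ?]] := chord_facts fm am bm (isT : 5 < 8).
have [lt6 [? ? ? ?]] := chord_facts fm am bm (isT : 6 < 8).
have [lt7 [? ? ? ?]] := chord_facts fm am bm (isT : 7 < 8).
have ? := sqa 0 isT; have ? := sqa 1 isT; have ? := sqa 2 isT; have ? := sqa 3 isT.
have ? := sqa 4 isT; have ? := sqa 5 isT; have ? := sqa 6 isT; have ? := sqa 7 isT.
have ? := sqb 0 isT; have ? := sqb 1 isT; have ? := sqb 2 isT; have ? := sqb 3 isT.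
have ? := sqb 4 isT; have ? := sqb 5 isT; have ? := sqb 6 isT; have ? := sqb 7 isT.
clear xa fE am bm sqa sqb xaE ybE fmE.
case: (lt8_cases lt0) => -[] E0; prune.
all: case: (lt8_cases lt1) => -[] E1; prune.
all: case: (lt8_cases lt2) => -[] E2; prune.
all: case: (lt8_cases lt3) => -[] E3; prune.
all: case: (lt8_cases lt4) => -[] E4; prune.
all: case: (lt8_cases lt5) => -[] E5; prune.
all: case: (lt8_cases lt6) => -[] E6; prune.
all: case: (lt8_cases lt7) => -[] E7; prune.
all: rewrite ?(E0, E1, E2, E3, E4, E5, E6, E7) in f0 f1 f2 f3 f4 f5 f6 f7.
all: rewrite ?f7 ?f6 ?f5 ?f4 ?f3 ?f2 ?f1 ?f0 in alt alt15 alt37.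
all: have fsep := fun i j => @index_matching_exact2 8 f m i j fm.
all: try first [close_by alt fsep 0 1 | close_by alt fsep 0 3 | close_by alt fsep 0 5
              | close_by alt fsep 2 1 | close_by alt fsep 2 3 | close_by alt fsep 2 5
              | close_by alt fsep 4 1 | close_by alt fsep 4 3 | close_by alt fsep 4 5].
all: have ysep := fun i j => @index_matching_exact2 8 y b i j yb.
- by case: (ysep 1 5 isT isT); [rewrite -alt15; ring | congruence | congruence].
- by case: (ysep 1 5 isT isT); [rewrite -alt15; ring | congruence | congruence].
- by case: (ysep 3 7 isT isT); [rewrite -alt37; ring | congruence | congruence].
- by case: (ysep 3 7 isT isT); [rewrite -alt37; ring | congruence | congruence].
Qed.

(** In each of the two squares [0, 1, 2, 3] and [4, 5, 6, 7] opposite values of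
    [f] have the same sum as the other two values.  A chord of [m] inside a square
    would make all sums of opposite values equal and put four points on one line,
    so [m] maps the first square onto the second; for the same reason it sends
    opposite corners to opposite corners.  Hence the centres agree under [f], and
    the displacement along an edge of the first square reappears in the second,
    along an edge of the other class (first two cases) or of the same class
    (last two cases). *)
Lemma square_crossing x y f c d a b m :
    map a (iota 0 8) = [:: 1; 0; 3; 2; 5; 4; 7; 6] ->
    map b (iota 0 8) = [:: 3; 2; 1; 0; 7; 6; 5; 4] ->
    index_matching 8 x a -> index_matching 8 y b ->
    (forall i, f i = c * x i + d * y i)%R -> index_matching 8 f m ->
    disjoint_matchings 8 a m -> disjoint_matchings 8 b m ->
  (f 0%N + f 2%N = f 4%N + f 6%N)%R /\
  [\/ d * (y 0%N - y 2%N) = c * (x 4%N - x 6%N),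
      d * (y 0%N - y 2%N) = - (c * (x 4%N - x 6%N)),
      d * (y 0%N - y 2%N) = d * (y 4%N - y 6%N)
    | d * (y 0%N - y 2%N) = - (d * (y 4%N - y 6%N))]%R.
Proof.
case=> a0 a1 a2 a3 a4 a5 a6 a7 [b0 b1 b2 b3 b4 b5 b6 b7] xa yb fE fm am bm.
have xaE i (lti : i < 8) := index_matching_val xa lti.
have ybE i (lti : i < 8) := index_matching_val yb lti.
have := (xaE 0 isT, xaE 2 isT, xaE 4 isT, xaE 6 isT).
rewrite a0 a2 a4 a6 => -[[[x1 x3] x5] x7].
have := (ybE 2 isT, ybE 0 isT, ybE 6 isT, ybE 4 isT).
rewrite b2 b0 b6 b4 => -[[[y1 y3] y5] y7].
have fE1 : (f 1%N = c * x 0%N + d * y 2%N)%R by rewrite fE x1 y1.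
have fE3 : (f 3%N = c * x 2%N + d * y 0%N)%R by rewrite fE x3 y3.
have fE5 : (f 5%N = c * x 4%N + d * y 6%N)%R by rewrite fE x5 y5.
have fE7 : (f 7%N = c * x 6%N + d * y 4%N)%R by rewrite fE x7 y7.
have sq : (f 0%N + f 2%N = f 1%N + f 3%N)%R by rewrite fE1 fE3 !fE; ring.
have alt : (f 0%N + f 2%N + f 4%N + f 6%N = f 1%N + f 3%N + f 5%N + f 7%N)%R.
  by rewrite fE1 fE3 fE5 fE7 !fE; ring.
have alt' : (f 0%N + f 2%N + f 5%N + f 7%N = f 1%N + f 3%N + f 4%N + f 6%N)%R.
  by rewrite fE1 fE3 fE5 fE7 !fE; ring.
have fmE i (lti : i < 8) := index_matching_val fm lti.
have f0 := fmE 0 isT; have f1 := fmE 1 isT; have f2 := fmE 2 isT; have f3 := fmE 3 isT.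
have f4 := fmE 4 isT; have f5 := fmE 5 isT; have f6 := fmE 6 isT; have f7 := fmE 7 isT.
have diff : (f 0%N - f 1%N = f (m 0) - f (m 1))%R by rewrite f0 f1.
have center : (f 0%N + f 2%N = f (m 0) + f (m 2))%R by rewrite f0 f2.
have [lt0 [? ? ? ?]] := chord_facts fm am bm (isT : 0 < 8).
have [lt1 [? ? ? ?]] := chord_facts fm am bm (isT : 1 < 8).
have [lt2 [? ? ? ?]] := chord_facts fm am bm (isT : 2 < 8).
have [lt3 [? ? ? ?]] := chord_facts fm am bm (isT : 3 < 8).
have [lt4 [? ? ? ?]] := chord_facts fm am bm (isT : 4 < 8).
have [lt5 [? ? ? ?]] := chord_facts fm am bm (isT : 5 < 8).
have [lt6 [? ? ? ?]] := chord_facts fm am bm (isT : 6 < 8).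
have [lt7 [? ? ? ?]] := chord_facts fm am bm (isT : 7 < 8).
have fEs := (fE 0, fE 2, fE 4, fE 6).
clear xa yb am bm xaE ybE fmE fE.
case: (lt8_cases lt0) => -[] E0; prune.
all: case: (lt8_cases lt1) => -[] E1; prune.
all: case: (lt8_cases lt2) => -[] E2; prune.
all: case: (lt8_cases lt3) => -[] E3; prune.
all: case: (lt8_cases lt4) => -[] E4; prune.
all: case: (lt8_cases lt5) => -[] E5; prune.
all: case: (lt8_cases lt6) => -[] E6; prune.
all: case: (lt8_cases lt7) => -[] E7; prune.
all: rewrite ?(E0, E1, E2, E3, E4, E5, E6, E7) in f0 f1 f2 f3 f4 f5 f6 f7 diff center.
(* Only the matchings announced above survive the three relations. *)
all: have fsep := fun i j => @index_matching_exact2 8 f m i j fm.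
all: try (exfalso; move: sq alt alt';
  rewrite ?f7 ?f6 ?f5 ?f4 ?f3 ?f2 ?f1 ?f0 => sq alt alt';
  first [close_by sq fsep 0 1 | close_by alt fsep 0 5 | close_by alt fsep 4 1
       | close_by alt' fsep 0 4 | close_by alt' fsep 5 1
       | close_by alt fsep 0 1 | close_by alt fsep 0 3
       | close_by alt fsep 2 1 | close_by alt fsep 2 3]).
all: split; first by rewrite center; first [ring | rewrite fE5 fE7 !fEs; ring].
all: rewrite ?fE1 ?fE3 ?fE5 ?fE7 ?fEs in diff.
all: first [ by constructor 1; apply: (eq_of_sub diff); ring
           | by constructor 2; apply: (eq_of_sub diff); ring
           | by constructor 3; apply: (eq_of_sub diff); ring
           | by constructor 4; apply: (eq_of_sub diff); ring ].
Qed.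

End IndexMatchings.


(** * Labelling an even set by alternating walks *)

Section Walks.

Variables (T : finType) (R : comUnitRingType) (S : {set T}).
Implicit Types (f g : T -> R) (n : T -> T).

Lemma matchingK f n : matching S f n -> {in S, forall p, n (n p) = p}.
Proof.
move=> fn p pS; have [npS np fnp ex] := fn p pS.
have [_ nnp fnnp _] := fn _ npS; have [nnpS _ _ _] := fn _ npS.
by case: (ex _ nnpS) => [|//|e]; [rewrite fnnp | rewrite e eqxx in nnp].
Qed.

Lemma matching_neq f g n n' : separated S f g -> matching S f n -> matching S g n' ->
  {in S, forall p, n p <> n' p}.
Proof.
move=> sep fn gn p pS e; have [npS /eqP np fnp _] := fn p pS.
by have [_ _ gnp _] := gn p pS; apply: np; apply: sep; rewrite // e.
Qed.

Lemma index_matchingP k (p : nat -> T) f n m :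
    (forall i, i < k -> p i \in S) ->
    (forall i j, i < k -> j < k -> p i = p j -> i = j) ->
    matching S f n ->
    (forall i, i < k -> m i < k /\ n (p i) = p (m i)) ->
  index_matching k (f \o p) m.
Proof.
move=> pS pinj fn nm i lti; have [ltm nmi] := nm i lti.
have [_ nmm] := nm _ ltm.
have [_ /eqP np fnp ex] := fn _ (pS i lti); rewrite /= -nmi.
split=> //.
- by move=> e; apply: np; rewrite nmi e.
- apply: pinj => //; first by case: (nm _ ltm).
  by rewrite -nmm -nmi (matchingK fn) ?pS.
move=> j ltj /(ex _ (pS j ltj)); rewrite nmi.
by case=> /pinj ->; auto.
Qed.

Lemma uniq_mkseq k (p : nat -> T) :
  (forall i j, i < k -> j < k -> p i = p j -> i = j) -> uniq (mkseq p k).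
Proof.
by move=> pinj; rewrite map_inj_in_uniq ?iota_uniq // => i j; rewrite !mem_iota; apply: pinj.
Qed.

Lemma label_onto k (p : nat -> T) :
    (forall i, i < k -> p i \in S) ->
    (forall i j, i < k -> j < k -> p i = p j -> i = j) -> #|S| = k ->
  S =i mkseq p k.
Proof.
move=> pS pinj cardS.
have sub : {subset mkseq p k <= enum S}.
  by move=> _ /mapP[i ltik ->]; rewrite mem_enum pS //; rewrite mem_iota in ltik.
have [|_ e] := uniq_min_size (uniq_mkseq pinj) sub.
  by rewrite size_mkseq -cardE cardS.
by move=> q; rewrite e mem_enum.
Qed.

Lemma index_matching_exists k (p : nat -> T) f n :
    (forall i, i < k -> p i \in S) ->
    (forall i j, i < k -> j < k -> p i = p j -> i = j) -> #|S| = k ->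
    matching S f n ->
  exists m, forall i, i < k -> m i < k /\ n (p i) = p (m i).
Proof.
move=> pS pinj cardS fn; pose s := mkseq p k.
exists (fun i => index (n (p i)) s) => i lti.
have ns : n (p i) \in s by rewrite -label_onto //; case: (fn _ (pS i lti)).
have ltm : index (n (p i)) s < k by rewrite -[X in _ < X](size_mkseq p) index_mem.
by split=> //; rewrite -[RHS](nth_mkseq (p 0) p ltm) nth_index.
Qed.

Lemma index_matching_table k (p : nat -> T) f n a :
    (forall i, i < k -> p i \in S) ->
    (forall i j, i < k -> j < k -> p i = p j -> i = j) ->
    matching S f n -> (forall i, i < k -> n (p i) = p (a i)) ->
    all (fun i => a i < k) (iota 0 k) ->
  index_matching k (f \o p) a.
Proof.
move=> pS inj fn na /allP lta; apply: (index_matchingP pS inj fn) => i lti.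
by split; rewrite ?na // lta // mem_iota.
Qed.

Variables (f0 f1 : T -> R) (n0 n1 : T -> T).
Hypotheses (sep01 : separated S f0 f1).
Hypotheses (fn0 : matching S f0 n0) (fn1 : matching S f1 n1).

(** The walk that follows the two matchings in turn, starting with [n0]. *)
Fixpoint walk p i := if i is j.+1 then (if odd j then n1 else n0) (walk p j) else p.

Lemma walk_in p i : p \in S -> walk p i \in S.
Proof.
move=> pS; elim: i => //= i wS.
by case: ifP => _; [case: (fn1 wS) | case: (fn0 wS)].
Qed.

Lemma walk_back p i : p \in S -> (if odd i then n1 else n0) (walk p i.+1) = walk p i.
Proof.
move=> pS /=; have wS := walk_in i pS.
by case: ifP => _; [rewrite (matchingK fn1) | rewrite (matchingK fn0)].
Qed.

(** If two points at odd distance on the walk coincided, so would the point after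
    the first and the point before the second, and finally two consecutive points;
    but a matching fixes no point. *)
Lemma walk_odd_gap p i d : p \in S -> walk p i <> walk p (i + d.*2.+1).
Proof.
move=> pS; elim: d i => [|d IHd] i.
  rewrite addn1 /=; have wS := walk_in i pS.
  by case: ifP => _ /esym/eqP; [case: (fn1 wS) | case: (fn0 wS)] => _ /negPf->.
move=> e; apply: (IHd i.+1); have := walk_back (i.+1 + d.*2.+1) pS.
rewrite (_ : odd (i.+1 + d.*2.+1) = odd i); last by lia.
by rewrite (_ : (i.+1 + d.*2.+1).+1 = i + d.+1.*2.+1) -?e; last by lia.
Qed.

(** At even distance both points can be moved back together. *)
Lemma walk_even_gap p i d : p \in S ->
  walk p i = walk p (i + d.*2) -> p = walk p d.*2.
Proof.
move=> pS; elim: i => //= i IHi; rewrite (_ : odd (i + d.*2) = odd i); last by lia.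
move=> e; apply: IHi; rewrite -(walk_back i pS) /= e.
by have := walk_back (i + d.*2) pS; rewrite /= (_ : odd (i + d.*2) = odd i) //; lia.
Qed.

Lemma walk2_neq p : p \in S -> p <> walk p 2.
Proof.
move=> pS e; have n0S : n0 p \in S by case: (fn0 pS).
by apply: (matching_neq sep01 fn0 fn1 n0S); rewrite (matchingK fn0).
Qed.

Lemma walk_inj p k : p \in S -> (forall d, 1 < d -> d.*2 < k -> p <> walk p d.*2) ->
  forall i j, i < k -> j < k -> walk p i = walk p j -> i = j.
Proof.
move=> pS open i j; wlog ltij : i j / i < j => [hw lti ltj e|lti ltj].
  by case: (ltngtP i j) => // [/hw|/hw] -> //; rewrite e.
have [od | ev] := boolP (odd (j - i)).
  have -> : j = i + (j - i)./2.*2.+1 by lia.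
  by move/(walk_odd_gap pS).
have -> : j = i + (j - i)./2.*2 by lia.
move/(walk_even_gap pS) => e; exfalso; have [d1 | d1] := ltnP 1 (j - i)./2.
  by apply: open e => //; lia.
by apply: (walk2_neq pS); rewrite {1}e; congr walk; lia.
Qed.

(** A walk with [#|S|] distinct points exhausts [S], so it goes on to one of them;
    the parities and the even gaps leave only its origin. *)
Lemma walk_closes p k : p \in S -> #|S| = k.*2 ->
    (forall d, 1 < d -> d.*2 < k.*2 -> p <> walk p d.*2) ->
  p = walk p k.*2.
Proof.
move=> pS cardS open; have inj := walk_inj pS open.
have wS i : i < k.*2 -> walk p i \in S by move=> _; apply: walk_in.
have /mapP[j] : walk p k.*2 \in mkseq (walk p) k.*2.
  by rewrite -label_onto // walk_in.
rewrite mem_iota /= => ltj e; have [od | ev] := boolP (odd j).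
  case: (@walk_odd_gap p j (k - j./2.+1) pS); rewrite -e; congr walk; lia.
case: (posnP j) => [j0|j_gt0]; first by rewrite e j0.
have := @walk_even_gap p j (k - j./2) pS; rewrite -e (_ : j + _ = k.*2); last by lia.
move=> /(_ erefl) e0.
have := @inj 0 (k - j./2).*2; rewrite /= => /(_ _ _ e0); lia.
Qed.

(** Two points left over by a set closed under both matchings would be matched
    to each other by both. *)
Lemma closed_card (s : seq T) : uniq s -> {subset s <= S} ->
  (forall q, q \in s -> n0 q \in s /\ n1 q \in s) -> #|S| <> (size s).+2.
Proof.
move=> us sub st cardS; pose Q := S :\: [set q in s].
have cardQ : #|Q| == 2.
  have sS : [set q in s] \subset S by apply/subsetP=> q; rewrite inE => /sub.
  by rewrite cardsD (setIidPr sS) cardS cardsE (card_uniqP us); lia.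
have QE q : (q \in Q) = (q \in S) && (q \notin s) by rewrite !inE andbC.
clearbody Q; have /cards2P[q [r [_ Qqr]]] := cardQ.
have : q \in Q by rewrite Qqr !inE eqxx.
rewrite QE => /andP[qS qs].
have stay n f : matching S f n -> (forall q, q \in s -> n q \in s) -> n q = r.
  move=> fn stn; have [nS nq _ _] := fn q qS.
  have : n q \in Q.
    by rewrite QE nS; apply: contra qs => /stn; rewrite (matchingK fn).
  by rewrite Qqr !inE (negPf nq) => /eqP.
apply: (matching_neq sep01 fn0 fn1 qS); rewrite (stay n0 f0) ?(stay n1 f1) //.
  by move=> x /st[].
by move=> x /st[].
Qed.

Lemma walk_closed p k : p \in S -> p = walk p k.+1.*2 ->
  forall i, i < k.+1.*2 ->
    n0 (walk p i) = walk p (if odd i then i.-1 else i.+1) /\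
    n1 (walk p i) = walk p (if odd i then (if i.+1 == k.+1.*2 then 0 else i.+1)
                            else if i is 0 then k.*2.+1 else i.-1).
Proof.
move=> pS e [|i] lti.
  by split=> //; have := walk_back k.*2.+1 pS; rewrite -doubleS -e oddS odd_double.
rewrite /=; have := walk_back i pS; rewrite /=; case: (boolP (odd i)) => oi /= wb.
  by rewrite oi.
rewrite wb; split=> //; case: eqP => [e2|_] /=; last by rewrite (negPf oi).
by rewrite [RHS]e -e2 /= (negPf oi).
Qed.

Lemma closed_walk_card p k : p \in S -> p = walk p k.+1.*2 ->
    (forall d, 1 < d -> d.*2 < k.+1.*2 -> p <> walk p d.*2) ->
  #|S| <> k.+2.*2.
Proof.
move=> pS e open; have inj := walk_inj pS open.
have -> : k.+2.*2 = (size (mkseq (walk p) k.+1.*2)).+2 by rewrite size_mkseq.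
apply: closed_card.
- exact: uniq_mkseq.
- by move=> _ /mapP[i _ ->]; apply: walk_in.
move=> q /mapP[i]; rewrite mem_iota add0n => lti ->; have [-> ->] := walk_closed pS e lti.
split; apply: map_f; rewrite mem_iota add0n; first by case: ifP; lia.
by case: ifP => [|_]; [case: eqP | case: i lti => [|i]]; lia.
Qed.

End Walks.


(** * Even sets for four directions have at least ten points *)

Section SmallEvenSets.

Variables (T : finType) (R : comUnitRingType) (S : {set T}).
Implicit Types (f g x y : T -> R) (n : T -> T) (c d : R).
Hypothesis unit2 : (2 : R)%R \is a GRing.unit.

Lemma separated_comb_l f0 f1 f c d : separated S f0 f1 -> d \is a GRing.unit ->
  (forall p, f p = c * f0 p + d * f1 p)%R -> separated S f0 f.
Proof.
move=> sep d_unit fE p q pS qS e0; rewrite !fE e0 => /addrI/(mulrI d_unit).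
exact: sep.
Qed.

Lemma separated_sym f g : separated S f g -> separated S g f.
Proof. by move=> sep p q pS qS eg ef; apply: sep. Qed.

Lemma separated_comb_r f0 f1 f c d : separated S f0 f1 -> c \is a GRing.unit ->
  (forall p, f p = c * f0 p + d * f1 p)%R -> separated S f1 f.
Proof.
move=> /separated_sym sep c_unit fE; apply: (@separated_comb_l _ f0 f d c) => // p.
by rewrite fE addrC.
Qed.

Lemma disjoint_index k (p : nat -> T) f g n n' a m :
    (forall i, i < k -> p i \in S) -> separated S f g ->
    matching S f n -> matching S g n' ->
    (forall i, i < k -> n (p i) = p (a i)) ->
    (forall i, i < k -> n' (p i) = p (m i)) ->
  disjoint_matchings k a m.
Proof.
move=> pS sep fn gn' na n'm i lti e.
by apply: (matching_neq sep fn gn' (pS i lti)); rewrite na // n'm // e.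
Qed.

(** In six points the walk along two matchings is a hexagon, and any third class
    matches antipodes of it. *)
Lemma matched_antipode f0 f1 f n0 n1 n c d p :
    separated S f0 f1 -> matching S f0 n0 -> matching S f1 n1 -> matching S f n ->
    c \is a GRing.unit -> d \is a GRing.unit ->
    (forall p, f p = c * f0 p + d * f1 p)%R -> #|S| = 6 -> p \in S ->
  n p = walk n0 n1 p 3.
Proof.
move=> sep fn0 fn1 fn c_unit d_unit fE cardS pS; pose w := walk n0 n1 p.
have wS i : i < 6 -> w i \in S by move=> _; apply: (walk_in fn0 fn1).
have open k : 1 < k -> k.*2 < 6 -> p <> w k.*2.
  move=> k1 k3 e; have k2 : k = 2 by lia.
  apply: (@closed_walk_card _ _ _ _ _ _ _ sep fn0 fn1 p 1) => //; first by rewrite -k2.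
  by case=> [|[|]].
have inj := walk_inj sep fn0 fn1 pS open.
have clos := @walk_closed _ _ _ _ _ _ _ fn0 fn1 p 2 pS
  (walk_closes sep fn0 fn1 pS (k := 3) cardS open).
have [m nm] := index_matching_exists wS inj cardS fn.
have na i : i < 6 -> n0 (w i) = w (nth 0 [:: 1; 0; 3; 2; 5; 4] i).
  by move=> lti; rewrite (clos i lti).1; case: i lti => [|[|[|[|[|[|]]]]]].
have nb i : i < 6 -> n1 (w i) = w (nth 0 [:: 5; 2; 1; 4; 3; 0] i).
  by move=> lti; rewrite (clos i lti).2; case: i lti => [|[|[|[|[|[|]]]]]].
have nm' i : i < 6 -> n (w i) = w (m i) by case/nm.
have xa := index_matching_table wS inj fn0 na isT.
have yb := index_matching_table wS inj fn1 nb isT.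
rewrite -[LHS]/(n (w 0%N)) nm' //; congr walk.
apply: (hexagon_antipode unit2 _ _ (index_matching_scale c_unit _ xa)
          (index_matching_scale d_unit _ yb) _ (index_matchingP wS inj fn nm)) => //.
- by move=> i /=; rewrite fE.
- exact: (disjoint_index wS (separated_comb_l sep d_unit fE) fn0 fn na nm').
- exact: (disjoint_index wS (separated_comb_r sep c_unit fE) fn1 fn nb nm').
Qed.

(** Two of the matchings never close up a 4-cycle in eight points: the other
    four points would form a second square, and by [square_crossing] for [f2] and
    [f3] the two squares have the same centre.  Squares with the same centre and
    equal edges in one class would share the values of that class on their
    corners, against the matching, so [n2] and [n3] carry the edges of one class to
    edges of the other, with length ratio [1] for [f2] and [c / d] for [f3], up to
    sign. *)
Lemma no_square f0 f1 f2 f3 n0 n1 n2 n3 c d :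
    separated S f0 f1 -> matching S f0 n0 -> matching S f1 n1 ->
    matching S f2 n2 -> matching S f3 n3 ->
    (forall p, f2 p = f0 p + f1 p)%R -> (forall p, f3 p = c * f0 p + d * f1 p)%R ->
    [/\ c \is a GRing.unit, d \is a GRing.unit, (c + d)%R \is a GRing.unit
      & (c - d)%R \is a GRing.unit] ->
    #|S| = 8 ->
  {in S, forall p, n1 (n0 p) <> n0 (n1 p)}.
Proof.
move=> sep fn0 fn1 fn2 fn3 f2E f3E [c_unit d_unit cpd_unit cmd_unit] cardS p pS com.
pose w := walk n0 n1; have e4 : p = w p 4.
  have n1S : n1 p \in S by have [] := fn1 p pS.
  by rewrite /w /= com (matchingK fn0) // (matchingK fn1).
have clos := @walk_closed _ _ _ _ _ _ _ fn0 fn1 p 1 pS e4.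
have open q : q \in S -> forall k, 1 < k -> k.*2 < 4 -> q <> w q k.*2.
  by move=> _ [|[|k]].
have injw q (qS : q \in S) := walk_inj sep fn0 fn1 qS (open q qS).
pose s := mkseq (w p) 4.
have wSq q i : q \in S -> w q i \in S by move=> qS; apply: (walk_in fn0 fn1).
have us : uniq s by apply: uniq_mkseq (injw p pS).
have [q qS qs] : exists2 q, q \in S & q \notin s.
  case: (pickP [pred q in S | q \notin s]) => [q /andP[]|no]; first by exists q.
  have : #|S| <= size s.
    rewrite -(card_uniqP us); apply/subset_leq_card/subsetP=> q qS.
    by have := no q; rewrite /= qS => /negbFE.
  by rewrite cardS size_mkseq.
have st z : z \in s -> n0 z \in s /\ n1 z \in s.
  move=> /mapP[i]; rewrite mem_iota => lti ->; have [-> ->] := clos i lti.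
  by split; apply: map_f; rewrite mem_iota; case: i lti => [|[|[|[|]]]].
have stq i : w q i \notin s.
  elim: i => //= i; apply: contra; have wS := wSq q i qS.
  by case: ifP => _ /st[st0 st1]; [rewrite -(matchingK fn1 wS) | rewrite -(matchingK fn0 wS)].
pose r i := if i < 4 then w p i else w q (i - 4).
have rS i : i < 8 -> r i \in S by move=> _; rewrite /r; case: ifP => _; apply: wSq.
have ws i : i < 4 -> w p i \in s by move=> lti; apply: map_f; rewrite mem_iota.
have inj i j : i < 8 -> j < 8 -> r i = r j -> i = j.
  rewrite /r => lti ltj; case: ltnP => [i4|i4]; case: ltnP => [j4|j4].
  - by apply: injw.
  - by move=> e; have := stq (j - 4); rewrite -e ws.
  - by move=> e; have := stq (i - 4); rewrite e ws.
  - move/(injw q qS) => e; rewrite -(subnK i4) -(subnK j4) e ?ltn_subLR //.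
have q4 : q = w q 4.
  have : w q 4 \in mkseq r 8 by rewrite -(label_onto rS inj cardS) wSq.
  case/mapP=> i; rewrite mem_iota add0n => lti; rewrite /r; case: ltnP => i4 e.
    by have := stq 4; rewrite e ws.
  have : i - 4 < 4 by rewrite ltn_subLR.
  case: (i - 4) e => [|[|[|[|]]]] // e _; rewrite e //.
  - by case: (@walk_odd_gap _ _ _ _ _ _ _ fn0 fn1 q 1 1 qS); exact: esym e.
  - case: (walk2_neq sep fn0 fn1 qS).
    by apply: (@walk_even_gap _ _ _ _ _ _ _ fn0 fn1 q 2 1 qS); exact: esym e.
  - by case: (@walk_odd_gap _ _ _ _ _ _ _ fn0 fn1 q 3 0 qS); exact: esym e.
have closq := @walk_closed _ _ _ _ _ _ _ fn0 fn1 q 1 qS q4.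
have na i : i < 8 -> n0 (r i) = r (nth 0 [:: 1; 0; 3; 2; 5; 4; 7; 6] i).
  move=> lti; rewrite {1}/r; case: ltnP => i4.
    by rewrite (clos i i4).1; case: i i4 {lti} => [|[|[|[|]]]].
  have i4' : i - 4 < 4 by rewrite ltn_subLR.
  rewrite (closq _ i4').1 -[in RHS](subnK i4).
  by case: (i - 4) i4' => [|[|[|[|]]]].
have nb i : i < 8 -> n1 (r i) = r (nth 0 [:: 3; 2; 1; 0; 7; 6; 5; 4] i).
  move=> lti; rewrite {1}/r; case: ltnP => i4.
    by rewrite (clos i i4).2; case: i i4 {lti} => [|[|[|[|]]]].
  have i4' : i - 4 < 4 by rewrite ltn_subLR.
  rewrite (closq _ i4').2 -[in RHS](subnK i4).
  by case: (i - 4) i4' => [|[|[|[|]]]].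
have xa := index_matching_table rS inj fn0 na isT.
have yb := index_matching_table rS inj fn1 nb isT.
have f2E' z : (f2 z = 1 * f0 z + 1 * f1 z)%R by rewrite f2E !mul1r.
have crossing f n c' d' : matching S f n ->
    c' \is a GRing.unit -> d' \is a GRing.unit ->
    (forall z, f z = c' * f0 z + d' * f1 z)%R ->
    (f (r 0) + f (r 2) = f (r 4) + f (r 6))%R /\
    [\/ d' * (f1 (r 0) - f1 (r 2)) = c' * (f0 (r 4) - f0 (r 6)),
        d' * (f1 (r 0) - f1 (r 2)) = - (c' * (f0 (r 4) - f0 (r 6))),
        d' * (f1 (r 0) - f1 (r 2)) = d' * (f1 (r 4) - f1 (r 6))
      | d' * (f1 (r 0) - f1 (r 2)) = - (d' * (f1 (r 4) - f1 (r 6)))]%R.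
  move=> fn c'_unit d'_unit fE; have [m nm] := index_matching_exists rS inj cardS fn.
  have nm' i : i < 8 -> n (r i) = r (m i) by case/nm.
  apply: (square_crossing unit2 _ _ xa yb (fun i => fE (r i))
            (index_matchingP rS inj fn nm)) => //.
  - exact: (disjoint_index rS (separated_comb_l sep d'_unit fE) fn0 fn na nm').
  - exact: (disjoint_index rS (separated_comb_r sep c'_unit fE) fn1 fn nb nm').
have [cen2 alt2] := crossing f2 n2 1%R 1%R fn2 (unitr1 R) (unitr1 R) f2E'.
have [cen3 alt3] := crossing f3 n3 c d fn3 c_unit d_unit f3E.
have y_exact i : i < 8 -> f1 (r i) = f1 (r 0) -> i = 0 \/ i = 3.
  by move=> lti; apply: (index_matching_exact yb).
have cen : (f1 (r 0) + f1 (r 2) = f1 (r 4) + f1 (r 6))%R.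
  apply: (unit_eq cmd_unit).
  have e : (c * (f2 (r 0) + f2 (r 2)) - (f3 (r 0) + f3 (r 2)) =
            c * (f2 (r 4) + f2 (r 6)) - (f3 (r 4) + f3 (r 6)))%R by rewrite cen2 cen3.
  by apply: (eq_of_sub e); rewrite !f2E !f3E; ring.
have not46 : (f1 (r 0) - f1 (r 2) <> f1 (r 4) - f1 (r 6))%R.
  move=> e; have e2 : (f1 (r 0) + f1 (r 2) + (f1 (r 0) - f1 (r 2)) =
      f1 (r 4) + f1 (r 6) + (f1 (r 4) - f1 (r 6)))%R by rewrite cen e.
  have /(y_exact 4 isT)[] // : f1 (r 4) = f1 (r 0).
  by apply: (unit_eq unit2); apply: (eq_of_sub (esym e2)); ring.
have not64 : (f1 (r 0) - f1 (r 2) <> - (f1 (r 4) - f1 (r 6)))%R.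
  move=> e; have e2 : (f1 (r 0) + f1 (r 2) + (f1 (r 0) - f1 (r 2)) =
      f1 (r 4) + f1 (r 6) - (f1 (r 4) - f1 (r 6)))%R by rewrite cen e.
  have /(y_exact 6 isT)[] // : f1 (r 6) = f1 (r 0).
  by apply: (unit_eq unit2); apply: (eq_of_sub (esym e2)); ring.
have not02 : (f1 (r 0) - f1 (r 2) <> 0)%R.
  by move/eqP; rewrite subr_eq0 => /eqP/esym/(y_exact 2 isT)[].
rewrite !mul1r in alt2.
have neq c' : c' \is a GRing.unit -> (c' * (f1 (r 0) - f1 (r 2)) <> 0)%R.
  by move=> c'_unit /(unit_eq0 c'_unit).
case: alt2 alt3 => // e2; case=> [e3|e3|/(mulrI d_unit)//|];
  try by rewrite -mulrN => /(mulrI d_unit).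
- by apply: (neq _ cmd_unit); rewrite mulrBl e3 e2 subrr.
- by apply: (neq _ cpd_unit); rewrite mulrDl e3 e2 subrr.
- by apply: (neq _ cpd_unit); rewrite mulrDl e3 e2 mulrN addNr.
- by apply: (neq _ cmd_unit); rewrite mulrBl e3 e2 mulrN subrr.
Qed.

(** With 4-cycles excluded, the walk along [n0] and [n1] in eight points is an
    octagon; a hexagon would leave two points over. *)
Lemma no_octagon f0 f1 f n0 n1 n :
    separated S f0 f1 -> matching S f0 n0 -> matching S f1 n1 -> matching S f n ->
    (forall p, f p = f0 p + f1 p)%R ->
    {in S, forall p, n1 (n0 p) <> n0 (n1 p)} ->
    {in S, forall p, n (n0 p) <> n0 (n p)} ->
    {in S, forall p, n (n1 p) <> n1 (n p)} ->
  #|S| <> 8.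
Proof.
move=> sep fn0 fn1 fn fE sq01 sq0 sq1 cardS.
have /card_gt0P[p pS] : 0 < #|S| by rewrite cardS.
pose w := walk n0 n1 p.
have fE' z : (f z = 1 * f0 z + 1 * f1 z)%R by rewrite fE !mul1r.
have unit1 := unitr1 R.
have wS i : i < 8 -> w i \in S by move=> _; apply: (walk_in fn0 fn1).
have not4 : p <> w 4.
  move=> e; apply: (sq01 p pS); rewrite -[LHS](matchingK fn0); last exact: (wS 2).
  rewrite -[n0 (n1 (n0 p))](matchingK fn1); last exact: (wS 3).
  by rewrite -[n1 (n0 (n1 (n0 p)))]e.
have open k : 1 < k -> k.*2 < 8 -> p <> w k.*2.
  move=> k1 k4; have [k3|k2] := eqVneq k 3; last first.
    by case: k k1 k2 k4 => [|[|[|[|]]]].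
  rewrite k3 => e; apply: (@closed_walk_card _ _ _ _ _ _ _ sep fn0 fn1 p 2) => //.
  by case=> [|[|[|]]].
have inj := walk_inj sep fn0 fn1 pS open.
have clos := @walk_closed _ _ _ _ _ _ _ fn0 fn1 p 3 pS
  (walk_closes sep fn0 fn1 pS (k := 4) cardS open).
have [m nm] := index_matching_exists wS inj cardS fn.
have nm' i : i < 8 -> n (w i) = w (m i) by case/nm.
have na i : i < 8 -> n0 (w i) = w (nth 0 [:: 1; 0; 3; 2; 5; 4; 7; 6] i).
  by move=> lti; rewrite (clos i lti).1; case: i lti => [|[|[|[|[|[|[|[|]]]]]]]].
have nb i : i < 8 -> n1 (w i) = w (nth 0 [:: 7; 2; 1; 4; 3; 6; 5; 0] i).
  by move=> lti; rewrite (clos i lti).2; case: i lti => [|[|[|[|[|[|[|[|]]]]]]]].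
have xa := index_matching_table wS inj fn0 na isT.
have yb := index_matching_table wS inj fn1 nb isT.
apply: (octagon_conflict unit2 _ _ xa yb (fun i => fE (w i))
          (index_matchingP wS inj fn nm)) => //.
- exact: (disjoint_index wS (separated_comb_l sep unit1 fE') fn0 fn na nm').
- exact: (disjoint_index wS (separated_comb_r sep unit1 fE') fn1 fn nb nm').
- move=> i lti e; apply: (sq0 _ (wS i lti)).
  have lta := index_matching_lt xa lti; have [ltm _] := nm i lti.
  by rewrite na // nm' // nm' // na // e.
- move=> i lti e; apply: (sq1 _ (wS i lti)).
  have ltb := index_matching_lt yb lti; have [ltm _] := nm i lti.
  by rewrite nb // nm' // nm' // nb // e.
Qed.

Lemma even_fibres_scale f g c : c \is a GRing.unit -> (forall p, g p = c * f p)%R ->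
  even_fibres S f -> even_fibres S g.
Proof.
move=> c_unit gE evf p pS; rewrite (_ : fibre S g p = fibre S f p) ?evf //.
by apply/setP=> q; rewrite !inE !gE (inj_eq (mulrI c_unit)).
Qed.

Lemma matching_scale f g n c : c \is a GRing.unit -> (forall p, g p = c * f p)%R ->
  matching S f n -> matching S g n.
Proof.
move=> c_unit gE fn p pS; have [nS np fnp ex] := fn p pS; split=> //.
  by rewrite !gE fnp.
by move=> q qS; rewrite !gE => /(mulrI c_unit); apply: ex.
Qed.

Lemma separated_scale f g g' c : c \is a GRing.unit -> (forall p, g' p = c * g p)%R ->
  separated S f g -> separated S f g'.
Proof.
by move=> c_unit gE sep p q pS qS ef; rewrite !gE => /(mulrI c_unit); apply: sep.
Qed.

End SmallEvenSets.

(** The four classes [x], [y], [f2 = x + y] and [f3 = x - 2 * y] satisfy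
    [f3 = 3 * x - 2 * f2 = f2 - 3 * y], which gives the shapes required by the
    previous lemmas after rescaling by units.  In eight points the pairs
    [(x, y)], [(x, f2)] and [(y, f2)] are free of 4-cycles, so [no_octagon]
    applies; the sums and differences of coefficients met on the way involve only
    the primes 2, 3 and 5. *)
Theorem even_set_card_ge10 (T : finType) (R : comUnitRingType) (S : {set T})
    (x y : T -> R) :
    [/\ (2 : R)%R \is a GRing.unit, (3 : R)%R \is a GRing.unit & (5 : R)%R \is a GRing.unit] ->
    separated S x y -> even_fibres S x -> even_fibres S y ->
    even_fibres S (fun p => x p + y p)%R -> even_fibres S (fun p => x p - 2 * y p)%R ->
    S != set0 ->
  10 <= #|S|.
Proof.
move=> [unit2 unit3 unit5] sep ev0 ev1.
set f2 := (fun p => _ + _)%R; set f3 := (fun p => _ - _)%R.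
move=> ev2 ev3 S_neq0; rewrite leqNgt; apply/negP=> S_lt10.
have unit1 := unitr1 R.
have unitN (k : R) : k \is a GRing.unit -> (- k)%R \is a GRing.unit by rewrite unitrN.
have unit6 : (6 : R)%R \is a GRing.unit by rewrite (natrM R 2 3) unitrM unit2.
have unit4 : (4 : R)%R \is a GRing.unit by rewrite (natrM R 2 2) unitrM unit2.
have S_le8 : #|S| <= 8 by have := even_card ev0; lia.
have scale (c : R) (f : T -> R) : c \is a GRing.unit ->
    even_fibres S f -> even_fibres S (fun p => c * f p)%R.
  by move=> c_unit; apply: (even_fibres_scale c_unit).
have sep02 : separated S x f2.
  by apply: (separated_comb_l sep unit1 (c := 1)%R) => p; rewrite !mul1r.
have sep12 : separated S y f2.
  by apply: (separated_comb_r sep unit1 (d := 1)%R) => p; rewrite !mul1r.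
have sep03 : separated S x f3.
  by apply: (separated_comb_l sep (unitN _ unit2) (c := 1)%R) => p; rewrite mul1r mulNr.
have sep13 : separated S y f3.
  by apply: (separated_comb_r sep unit1 (d := -2)%R) => p; rewrite mul1r mulNr.
have sep23 : separated S f2 f3.
  apply: (separated_comb_l (separated_sym sep02) unit3 (c := -2)%R) => p.
  by rewrite /f2 /f3; ring.
have ex_matching (g h0 h1 h2 : T -> R) : separated S g h0 ->
    (forall p, h1 p = h0 p + 2 * g p)%R -> (forall p, h2 p = h0 p - g p)%R ->
    even_fibres S g -> even_fibres S h0 -> even_fibres S h1 -> even_fibres S h2 ->
    exists n, matching S g n.
  move=> sepg h1E h2E evg evh0 evh1 evh2; exists (partner S g).
  have card2 := fibre_card2 unit2 unit3 unit5 h1E h2E sepg (And4 evg evh0 evh1 evh2) S_le8.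
  by have [] := partner_matching card2.
have [nx mx] : exists n, matching S x n.
  apply: (ex_matching _ _ _ _ (separated_scale unit2 (fun=> erefl _) sep) _ _
            ev0 (scale _ _ unit2 ev1) (scale _ _ unit2 ev2) (scale _ _ (unitN _ unit1) ev3)).
  - by move=> p; rewrite /f2; ring.
  - by move=> p; rewrite /f3; ring.
have [ny my] : exists n, matching S y n.
  have [|||n mn] := ex_matching (fun p => (-1) * y p)%R x f3 f2 _ _ _
    (scale _ _ (unitN _ unit1) ev1) ev0 ev3 ev2.
  - exact/separated_sym/(separated_scale (unitN _ unit1) (fun=> erefl _) sep).
  - by move=> p; rewrite /f3; ring.
  - by move=> p; rewrite /f2; ring.
  by exists n; apply: (matching_scale (unitN _ unit1) _ mn) => p; ring.
have [n2 m2] : exists n, matching S f2 n.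
  apply: (ex_matching _ _ _ _ sep23 _ _ ev2 ev3 (scale _ _ unit3 ev0)
            (scale _ _ (unitN _ unit3) ev1)).
  - by move=> p; rewrite /f2 /f3; ring.
  - by move=> p; rewrite /f2 /f3; ring.
have [n3 m3] : exists n, matching S f3 n.
  have [|||n mn] := ex_matching (fun p => (-1) * f3 p)%R _ _ _ _ _ _
    (scale _ _ (unitN _ unit1) ev3) (scale _ _ unit2 ev2)
    (scale _ _ unit6 ev1) (scale _ _ unit3 ev0).
  - apply: (separated_scale unit2 (fun=> erefl _)); apply: separated_sym.
    exact: (separated_scale (unitN _ unit1) (fun=> erefl _) sep23).
  - by move=> p; rewrite /f2 /f3; ring.
  - by move=> p; rewrite /f2 /f3; ring.
  by exists n; apply: (matching_scale (unitN _ unit1) _ mn) => p; ring.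
have [p pS] := set0Pn _ S_neq0.
have cardS : #|S| = 6 \/ #|S| = 8.
  have us : uniq [:: p; nx p; ny p; n2 p; n3 p].
    have [nxS nxp _ _] := mx p pS; have [nyS nyp _ _] := my p pS.
    have [n2S n2p _ _] := m2 p pS; have [n3S n3p _ _] := m3 p pS.
    rewrite /= !inE !negb_or ![p == _]eq_sym nxp nyp n2p n3p /= andbT.
    apply/and3P; split; last by apply/eqP/(matching_neq sep23 m2 m3).
      apply/and3P; split; apply/eqP; first exact: (matching_neq sep mx my).
        exact: (matching_neq sep02 mx m2).
      exact: (matching_neq sep03 mx m3).
    apply/andP; split; apply/eqP; first exact: (matching_neq sep12 my m2).
    exact: (matching_neq sep13 my m3).
  have : 5 <= #|S|.
    rewrite -[5]/(size [:: p; nx p; ny p; n2 p; n3 p]) cardE; apply: uniq_leq_size us _.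
    move=> q; rewrite !inE mem_enum => /or4P[/eqP->|/eqP->|/eqP->|/orP[]/eqP->] //.
    + by case: (mx p pS).
    + by case: (my p pS).
    + by case: (m2 p pS).
    + by case: (m3 p pS).
  have := even_card ev0; move: S_le8; move: #|S| => k.
  by case: k => [|[|[|[|[|[|[|[|[|k]]]]]]]]] //; auto.
case: cardS => cardS.
  apply: (matching_neq sep23 m2 m3 pS).
  rewrite (matched_antipode unit2 sep mx my m2 unit1 unit1 _ cardS pS); last first.
    by move=> z; rewrite /f2; ring.
  rewrite (matched_antipode unit2 sep mx my m3 unit1 (unitN _ unit2) _ cardS pS) //.
  by move=> z; rewrite /f3; ring.
have minus (f : T -> R) n : matching S f n -> matching S (fun p => (-1) * f p)%R n.
  by apply: (matching_scale (unitN _ unit1)) => q.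
have sepN (f g : T -> R) : separated S f g -> separated S (fun p => (-1) * f p)%R g.
  by move=> /separated_sym sepfg; apply/separated_sym/(separated_scale (unitN _ unit1) _ sepfg).
apply: (no_octagon unit2 sep mx my m2 _ _ _ _ cardS) => //.
- apply: (@no_square _ _ _ unit2 _ _ _ _ _ _ _ _ 1%R (-2)%R sep mx my m2 m3) => //.
    by move=> z; rewrite /f3; ring.
  split; auto.
    by rewrite (_ : 1 + -2 = -1)%R; [auto | ring].
  by rewrite (_ : 1 - -2 = 3)%R; [auto | ring].
- apply: (@no_square _ _ _ unit2 _ _ _ _ _ _ _ _ (-3)%R (-2)%R
           (sepN _ _ sep02) (minus _ _ mx) m2 my m3) => //.
  + by move=> z; rewrite /f2; ring.
  + by move=> z; rewrite /f2 /f3; ring.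
  split; auto.
    by rewrite (_ : -3 + -2 = -5)%R; [auto | ring].
  by rewrite (_ : -3 - -2 = -1)%R; [auto | ring].
apply: (@no_square _ _ _ unit2 _ _ _ _ _ _ _ _ 3%R 1%R
         (sepN _ _ sep12) (minus _ _ my) m2 mx m3) => //.
+ by move=> z; rewrite /f2; ring.
+ by move=> z; rewrite /f2 /f3; ring.
split; auto.
  by rewrite (_ : 3 + 1 = 4)%R; [auto | ring].
by rewrite (_ : 3 - 1 = 2)%R; [auto | ring].
Qed.

Local Open Scope ring_scope.

(** * Block indices, residues and null spaces *)

Section UniformBlocks.
Variables K z : nat.

Definition blk (i : 'I_K) (j : 'I_z) : 'I_(\sum_(k < K) z) :=
  @tagnat.Rank K (fun=> z) i j.
Definition blk1 (s : 'I_(\sum_(k < K) z)) : 'I_K := tagnat.sig1 s.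
Definition blk2 (s : 'I_(\sum_(k < K) z)) : 'I_z := tagnat.sig2 s.

Lemma blkK s : blk (blk1 s) (blk2 s) = s.
Proof. exact: tagnat.sig2K. Qed.

Lemma blk1K i j : blk1 (blk i j) = i.
Proof. exact: tagnat.Rank1K. Qed.

Lemma blk2K i j : blk2 (blk i j) = j.
Proof. by apply: val_inj; rewrite [LHS](congr1 val (tagnat.Rank2K _)). Qed.

Lemma blk_inj i i' j j' : blk i j = blk i' j' -> i = i' /\ j = j'.
Proof.
by move=> e; have := (congr1 blk1 e, congr1 blk2 e); rewrite !blk1K !blk2K => -[].
Qed.

Lemma sum_blk (V : nmodType) (F : 'I_(\sum_(k < K) z) -> V) :
  \sum_i F i = \sum_k \sum_r F (blk k r).
Proof.
rewrite pair_big /= (reindex (fun p : 'I_K * 'I_z => blk p.1 p.2)) //=.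
exists (fun i => (blk1 i, blk2 i)) => [[k r]|i] _; last exact: blkK.
by rewrite /= blk1K blk2K.
Qed.

End UniformBlocks.

Lemma modz_Zp (N : nat) (m : int) : (m %% N.+2)%Z = (m%:~R : 'I_N.+2)%:Z.
Proof.
rewrite {2}(divz_eq m N.+2) intrD intrM.
have -> : (N.+2%:Z)%:~R = 0 :> 'I_N.+2 by exact: (@pchar_Zp N.+2).
rewrite mulr0 add0r; have := modz_ge0 m (isT : N.+2%:Z != 0).
have := @ltz_pmod m N.+2 isT; case: (m %% _)%Z => //= r; rewrite ltz_nat => ltr _.
by rewrite -[r%:Z%:~R]/(r%:R) (@val_Zp_nat N.+2) // modn_small.
Qed.

(** The full-rank factor [row_base A] has the same null space as [A] and is
    onto. *)
Lemma dim_code m n (A : 'M['F_2]_(m, n)) : (\dim (code A) + \rank A = n)%N.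
Proof.
pose g : 'Hom('cV['F_2]_n, 'cV['F_2]_(\rank A)) := linfun (mulmx (row_base A)).
have gE x : g x = row_base A *m x by rewrite lfunE.
have -> : code A = lker g.
  apply/vspaceP=> x; rewrite mem_code memv_ker gE -{1}(mulmx_base A) -mulmxA.
  apply/eqP/eqP=> [e|->]; last by rewrite mulmx0.
  by rewrite -[LHS]mul1mx -(mulVpmx (col_base_full A)) -mulmxA e mulmx0.
have := limg_ker_dim g fullv; rewrite capfv.
suff -> : (g @: fullv)%VS = fullv by rewrite !dimvf /dim /= !muln1.
apply/vspaceP=> y; rewrite memvf; apply/memv_imgP.
exists (pinvmx (row_base A) *m y); rewrite ?memvf // gE mulmxA mulmxVp ?mul1mx //.
exact: row_base_free.
Qed.

(** * Lines of the four classes *)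

Section Code.
Variable N : nat.
Local Notation a := N.+2.
Local Notation Za := 'I_N.+2.
Local Notation cols := (\sum_(i < a) a)%N.
Local Notation rows := (\sum_(k < 4) a)%N.
Variable alpha : nat.
Let al : Za := alpha%:R.

Definition xcoord (j : 'I_cols) : Za := blk1 j.
Definition ycoord (j : 'I_cols) : Za := blk2 j.

(** The row [r] of the block row [k] is the line [line k = r]. *)
Definition line (k : 'I_4) (j : 'I_cols) : Za :=
  match val k with
  | 0 => xcoord j
  | 1 => ycoord j
  | 2 => xcoord j + ycoord j
  | _ => al * xcoord j + ycoord j
  end.

Let H := construction1 (linear_array a alpha).

Lemma shift_mxE i (r c : Za) : shift_mx a i r c = (i%:R + c == r)%:R.
Proof.
rewrite mxE modz_Zp intrD rmorphN /= -[r%:Z%:~R]/(r%:R) natr_Zp -[i%:Z%:~R]/(i%:R).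
rewrite eqz_nat -[(_ == _ :> nat)]/(c == r - i%:R).
by rewrite eq_sym subr_eq eq_sym addrC.
Qed.

Lemma HE i j : H i j = (line (blk1 i) j == blk2 i)%:R.
Proof.
rewrite mxE /line -/(blk1 i) -/(blk2 i) -/(blk1 j) -/(blk2 j).
case: (blk1 i) => [[|[|[|[|k]]]] ltk] //=.
- by rewrite mxE eq_sym.
- by rewrite mxE eq_sym.
- by rewrite shift_mxE mxE /= inordK //= natr_Zp.
- by rewrite shift_mxE mxE /= inordK //= (@Zp_nat_mod a) // natrM natr_Zp.
Qed.

Hypothesis a_odd : odd a.
Hypothesis a_gcd3 : gcdn a 3 = 1%N.
Hypothesis a_gcd5 : gcdn a 5 = 1%N.
Hypothesis alphaE : alpha = ((a - 1) %/ 2)%N.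

Lemma unit2 : (2 : Za) \is a GRing.unit.
Proof. by rewrite -[2]/(2%:R) (@unitZpE a) // coprimen2. Qed.

Lemma unit3 : (3 : Za) \is a GRing.unit.
Proof. by rewrite -[3]/(3%:R) (@unitZpE a) // /coprime a_gcd3. Qed.

Lemma unit5 : (5 : Za) \is a GRing.unit.
Proof. by rewrite -[5]/(5%:R) (@unitZpE a) // /coprime a_gcd5. Qed.

(** This makes the fourth class the level lines of [x - 2 * y]. *)
Lemma double_al : 2 * al = -1.
Proof.
rewrite /al -natrM alphaE.
have -> : (2 * ((a - 1) %/ 2) = a - 1)%N by have := odd_double_half a; rewrite a_odd; lia.
by rewrite natrB // (@pchar_Zp a) // sub0r.
Qed.

Lemma alB1 : 2 * (al - 1) = -3.
Proof. by rewrite mulrBr double_al; ring. Qed.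

Lemma unit_al : al \is a GRing.unit.
Proof.
have : 2 * al \is a GRing.unit by rewrite double_al unitrN1.
by rewrite unitrM => /andP[].
Qed.

Lemma unit_alB1 : al - 1 \is a GRing.unit.
Proof.
have : 2 * (al - 1) \is a GRing.unit by rewrite alB1 unitrN unit3.
by rewrite unitrM => /andP[].
Qed.

Lemma coord_inj j j' : xcoord j = xcoord j' -> ycoord j = ycoord j' -> j = j'.
Proof. by move=> ex ey; rewrite -(blkK j) -(blkK j') -!/(xcoord _) -!/(ycoord _) ex ey. Qed.

Lemma line_sep k k' j j' : k != k' ->
  line k j = line k j' -> line k' j = line k' j' -> j = j'.
Proof.
wlog lt : k k' / (k < k')%N => [hw nek|_].
  case: (ltngtP k k') => [|lt e1 e2|/val_inj e]; first by move/hw; apply.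
    by apply: (hw k' k); rewrite // eq_sym.
  by rewrite e eqxx in nek.
have final dx : dx * (xcoord j - xcoord j') = 0 -> dx \is a GRing.unit ->
    (xcoord j = xcoord j' -> ycoord j = ycoord j') -> j = j'.
  by move=> e dxU ey; have ex := unit_eq dxU e; apply: coord_inj; rewrite ?ey.
case: k k' lt => [[|[|[|[|k]]]] ltk] [[|[|[|[|k']]]] ltk'] //= _; rewrite /line /=.
- exact: coord_inj.
- by move=> ex; rewrite ex => /addrI; apply: coord_inj.
- by move=> ex; rewrite ex => /addrI; apply: coord_inj.
- by move=> ey; rewrite ey => /addIr ex; apply: coord_inj.
- by move=> ey; rewrite ey => /addIr /(mulrI unit_al) ex; apply: coord_inj.
move=> e2 e3; have e : al * xcoord j + ycoord j - (xcoord j + ycoord j) =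
   al * xcoord j' + ycoord j' - (xcoord j' + ycoord j') by rewrite e2 e3.
have ex : xcoord j = xcoord j'.
  by apply: (unit_eq unit_alB1); apply: (eq_of_sub e); ring.
by move: e2; rewrite ex => /addrI; apply: coord_inj.
Qed.

Lemma line_bij k k' : k != k' -> bijective (fun j => (line k j, line k' j)).
Proof.
move=> nek; apply: inj_card_bij => [j j' [e e']|]; first exact: line_sep nek e e'.
by rewrite card_prod !card_ord sum_nat_const card_ord.
Qed.

(** A line meets every line of another class exactly once. *)
Lemma sum_line (V : nmodType) k k' r (F : Za -> V) : k != k' ->
  \sum_(j | line k j == r) F (line k' j) = \sum_s F s.
Proof.
move=> nek; have [g gK Kg] := line_bij nek.
rewrite (reindex (fun s => g (r, s))) /=.
  by apply: eq_big => [s|s _]; have [e1 e2] := Kg (r, s); rewrite ?e1 ?e2 ?eqxx.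
exists (line k') => [s _|j /eqP ej]; first by have [] := Kg (r, s).
by rewrite -ej gK.
Qed.

Lemma exists_other (k : 'I_4) : exists k', k != k'.
Proof. by exists (if k == ord0 then ord_max else ord0); case: (eqVneq k ord0) => [->|]. Qed.

Lemma card_line k r : #|[set j | line k j == r]| = a.
Proof.
have [k' nek] := exists_other k.
have e : (\sum_(j | line k j == r) 1 = \sum_(s : Za) 1)%N := sum_line r (fun=> 1%N) nek.
by rewrite -sum1dep_card e sum_nat_const card_ord muln1.
Qed.

(** * Regularity, quasi-cyclic form and girth *)

Lemma regular : regular_mx H (a ^ 2) 4 a.
Proof.
have oneP (b : bool) : (b%:R == 1 :> 'F_2) = b by case: b.
split=> [|j|i]; first by rewrite sum_nat_const card_ord.
  rewrite -[RHS](card_ord 4) -(card_imset _ (can_inj (fun k => blk1K k (line k j)))).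
  apply: eq_card => i; rewrite !inE HE oneP.
  apply/eqP/imsetP => [e|[k _ ->]]; last by rewrite blk1K blk2K.
  by exists (blk1 i); rewrite // e blkK.
rewrite -[RHS](card_line (blk1 i) (blk2 i)).
by apply: eq_card => j; rewrite !inE HE oneP.
Qed.

Lemma length_code : code_length H = (a ^ 2)%N.
Proof. by case: regular. Qed.


(** The translation of the plane by [(1, 1)] moves the lines of each class by the
    unit [line_step]; it acts freely on points and on the lines of each class, and
    its orbits are the blocks of the quasi-cyclic form. *)
Definition line_step (k : 'I_4) : Za :=
  match val k with 0 => 1 | 1 => 1 | 2 => 2 | _ => al + 1 end.

Lemma unit_line_step k : line_step k \is a GRing.unit.
Proof.
case: k => [[|[|[|[|k]]]] ltk] //; rewrite /line_step /= ?unitr1 ?unit2 //.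
have : 2 * (al + 1) \is a GRing.unit.
  by rewrite mulrDr double_al (_ : -1 + 2 * 1 = 1) ?unitr1 //; ring.
by rewrite unitrM => /andP[].
Qed.

Lemma quasi_cyclic_H : @quasi_cyclic _ 4 a a H.
Proof.
pose srow (i : 'I_rows) : 'I_rows := blk (blk1 i) (line_step (blk1 i) * blk2 i).
pose tcol (j : 'I_cols) : 'I_cols := blk (blk2 j) (blk2 j + blk1 j : Za).
have srow_inj : injective srow.
  move=> i i' /blk_inj[e1]; rewrite e1 => /(mulrI (unit_line_step _)) e2.
  by rewrite -(blkK i) -(blkK i') e1 e2.
have tcol_inj : injective tcol.
  by move=> j j' /blk_inj[e2]; rewrite e2 => /addrI e1; rewrite -(blkK j) -(blkK j') e1 e2.
exists (perm srow_inj), (perm tcol_inj) => k l r c.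
have entry (r' c' : Za) :
    submxblock (row_perm (perm srow_inj) (col_perm (perm tcol_inj) H)) k l r' c' =
    (line k (blk c' (c' + l)) == line_step k * r')%:R.
  rewrite 3!mxE !permE -/(blk k r') -/(blk l c') HE /srow /tcol.
  by rewrite !blk1K !blk2K.
rewrite !entry -!(@add_Zp_1 a).
have -> : line k (blk (c + 1) (c + 1 + l)) = line k (blk c (c + l)) + line_step k.
  rewrite /line /xcoord /ycoord !blk1K !blk2K /line_step.
  by case: k {entry} => [[|[|[|[|k]]]] ltk] //=; ring.
by rewrite mulrDr mulr1 (inj_eq (addIr _)).
Qed.

Lemma H1E i j : (H i j == 1) = (line (blk1 i) j == blk2 i).
Proof. by rewrite HE; case: (line _ _ == _). Qed.

Lemma no_4cycle i i' j j' : H i j == 1 -> H i j' == 1 -> H i' j == 1 -> H i' j' == 1 ->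
  i = i' \/ j = j'.
Proof.
rewrite !H1E => /eqP e1 /eqP e2 /eqP e3 /eqP e4.
have [ek|nek] := eqVneq (blk1 i) (blk1 i'); last first.
  by right; apply: (line_sep nek); rewrite ?e1 ?e2 ?e3 ?e4.
by left; rewrite -(blkK i) -(blkK i') -e1 -e3 ek.
Qed.

Lemma girth6 : girth_at_least (tanner H) 6.
Proof.
case=> [|u1 [|u2 [|u3 [|u4 [|u5 [|u6 c]]]]]] //=; rewrite /ucycle /ucycleb /=.
- by case: u1 u2 u3 => [?|?] [?|?] [?|?] /andP[/and4P[]].
- case: u1 u2 u3 u4 => [i1|j1] [i2|j2] [i3|j3] [i4|j4] //=; rewrite ?andbF //.
    case/andP=> /and5P[h1 h2 h3 h4 _]; rewrite !inE !negb_or.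
    move=> /and3P[/and3P[_ n13 _] /andP[_ n24] _].
    by case: (no_4cycle h1 h4 h2 h3) n13 n24 => ->; rewrite eqxx.
  case/andP=> /and5P[h1 h2 h3 h4 _]; rewrite !inE !negb_or.
  move=> /and3P[/and3P[_ n13 _] /andP[_ n24] _].
  by case: (no_4cycle h1 h2 h4 h3) n13 n24 => ->; rewrite eqxx.
by case: u1 u2 u3 u4 u5 => [?|?] [?|?] [?|?] [?|?] [?|?] //=; rewrite ?andbF.
Qed.


(** * Rate *)

Lemma mulHE (v : 'rV_rows) j : (v *m H) ord0 j = \sum_k v ord0 (blk k (line k j)).
Proof.
rewrite mxE sum_blk; apply: eq_bigr => k _; rewrite (bigD1 (line k j)) //=.
rewrite HE blk1K blk2K eqxx mulr1 [X in _ + X]big1 ?addr0 // => r ner.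
by rewrite HE blk1K blk2K eq_sym (negPf ner) mulr0.
Qed.

(** Sum the relation [v *m H = 0] over the points of one line of class [k]: by
    [sum_line] the other classes contribute constants, and class [k] contributes
    [a] times the entry of [v] at that line, where [a] is odd. *)
Lemma left_kernel_const (v : 'rV_rows) k r : v *m H = 0 ->
  v ord0 (blk k r) = v ord0 (blk k 0).
Proof.
move=> vH0; suff main s : v ord0 (blk k s) = - \sum_(k' | k' != k) \sum_t v ord0 (blk k' t).
  by rewrite !main.
apply/eqP; rewrite -addr_eq0; apply/eqP.
transitivity (\sum_(j | line k j == s) (v *m H) ord0 j); last first.
  by rewrite vH0; apply: big1 => j _; rewrite mxE.
under [RHS]eq_bigr => j _ do rewrite mulHE.
rewrite [RHS]exchange_big /= [RHS](bigD1 k) //=; congr (_ + _).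
  rewrite (eq_bigr (fun=> v ord0 (blk k s))); last by move=> j /eqP->.
  have := card_line k s; rewrite cardsE => card_ks.
  rewrite [RHS]sumr_const card_ks -mulr_natl.
  by rewrite -(@Fp_nat_mod 2) // modn2 a_odd mul1r.
by apply: eq_bigr => k' nek; rewrite (sum_line s (fun t => v ord0 (blk k' t))) // eq_sym.
Qed.

(** A vector of the left kernel is constant on each class, and the four constants
    sum to zero; the rows of [W], each joining the first class to another one, are
    a basis. *)
Lemma rank_H : \rank H = (4 * a - 3)%N.
Proof.
pose W : 'M['F_2]_(3, rows) :=
  \matrix_(t, i) ((blk1 i == ord0)%:R + (blk1 i == lift ord0 t)%:R).
have WE t k r : W t (blk k r) = (k == ord0)%:R + (k == lift ord0 t)%:R by rewrite mxE blk1K.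
have W_free : row_free W.
  apply/row_freeP; exists (\matrix_(i, t) (i == blk (lift ord0 t) 0)%:R).
  apply/matrixP=> s t; rewrite !mxE (bigD1 (blk (lift ord0 t) 0)) //=.
  rewrite [X in _ + X]big1 => [|i nei]; last by rewrite mxE (negPf nei) mulr0.
  rewrite !mxE blk1K eqxx mulr1 addr0 (inj_eq lift_inj) [t == s]eq_sym.
  by rewrite add0r.
have WH : W *m H = 0.
  apply/row_matrixP=> t; rewrite row_mul row0; apply/rowP=> j; rewrite mulHE [RHS]mxE.
  under eq_bigr => k _ do rewrite mxE WE.
  rewrite big_split /= (bigD1 ord0) //= [X in _ + X + _]big1 => [|k /negPf->] //.
  rewrite (bigD1 (lift ord0 t)) //= [X in _ + (_ + X)]big1 => [|k /negPf->] //.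
  by rewrite !eqxx !addr0; apply/val_inj.
have kerW : (kermx H == W)%MS.
  apply/andP; split; last by apply/sub_kermxP.
  apply/row_subP=> i; set v := row i _.
  have vH0 : v *m H = 0 by apply/sub_kermxP; rewrite row_sub.
  clearbody v.
  have sum0 : \sum_k v ord0 (blk k 0) = 0.
    have := congr1 (fun M : 'rV_cols => M ord0 (blk 0 0)) vH0; rewrite mulHE mxE.
    by under eq_bigr => k _ do rewrite left_kernel_const //.
  apply/submxP; exists (\row_t v ord0 (blk (lift ord0 t) 0)).
  have span (c : 'I_4 -> 'F_2) k : \sum_k' c k' = 0 ->
      c k = \sum_t c (lift ord0 t) * ((k == ord0)%:R + (k == lift ord0 t)%:R).
    move=> c0; under eq_bigr => t _ do rewrite mulrDr.
    rewrite big_split /= -mulr_suml; case: (unliftP ord0 k) => [t|] ->.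
      rewrite mulr0 add0r (bigD1 t) //= eqxx mulr1 big1 ?addr0 // => s nes.
      by rewrite (inj_eq lift_inj) eq_sym (negPf nes) mulr0.
    rewrite eqxx mulr1 [X in _ + X]big1 ?addr0; last by move=> t _; rewrite mulr0.
    move: c0; rewrite big_ord_recl => /eqP; rewrite addr_eq0 => /eqP->.
    by rewrite oppr_pchar2 // pchar_Fp.
  apply/rowP=> i'; rewrite -(blkK i') left_kernel_const // (span _ _ sum0) [RHS]mxE.
  by apply: eq_bigr => t _; rewrite mxE WE.
have := mxrank_ker H; rewrite (eqmxP kerW) (eqP W_free).
have := rank_leq_row H; move: (\rank H) => rk; rewrite sum_nat_const card_ord; lia.
Qed.

Lemma rate_H : rate H = 1 - (4 * a%:R - 3) / a%:R ^+ 2.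
Proof.
have := dim_code H; rewrite rank_H /rate length_code; move: (\dim _) => d.
rewrite -[cols]/(code_length H) length_code => dE.
have a0 : (a%:R : rat) != 0 by rewrite pnatr_eq0.
have : (d%:R + (4 * a - 3)%:R : rat) = (a ^ 2)%:R by rewrite -natrD dE.
rewrite natrB; last by lia.
rewrite natrM natrX => e; apply: (mulIf (expf_neq0 2 a0)).
rewrite mulrBl !divfK ?expf_neq0 // -e; ring.
Qed.


(** * The difference matrix *)

(** Column [g] of the array is [i |-> multiplier g * i], so differences of columns
    are multiplications by differences of multipliers. *)
Definition multiplier (g : 'I_3) : Za := match val g with 0 => 0 | 1 => 1 | _ => al end.

Lemma linear_arrayE i g : linear_array a alpha i g = multiplier g * i :> nat.
Proof.
case: g => [[|[|[|g]]] ltg] //; rewrite mxE.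
- by have -> : multiplier (Ordinal ltg) = 0 by []; rewrite mul0r.
- by have -> : multiplier (Ordinal ltg) = 1 by []; rewrite mul1r.
have -> : multiplier (Ordinal ltg) = al by [].
by rewrite -[X in _ = nat_of_ord (_ * X)]natr_Zp -natrM (@val_Zp_nat a).
Qed.

Lemma mem_unit_multiples (u : Za) : u \is a GRing.unit ->
  [seq val (u * i) | i : Za] =i iota 0 a.
Proof.
move=> u_unit k; rewrite mem_iota add0n; apply/mapP/idP => [[i _ ->]|ltk].
  exact: ltn_ord.
by exists (u^-1 * Ordinal ltk); rewrite ?mem_enum // mulrA mulrV ?mul1r.
Qed.

Lemma unit_multiplierB g g' : g != g' -> multiplier g - multiplier g' \is a GRing.unit.
Proof.
rewrite /multiplier; case: g g' => [[|[|[|g]]] ltg] [[|[|[|g']]] ltg'] //= _.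
- by rewrite sub0r unitrN1.
- by rewrite sub0r unitrN unit_al.
- by rewrite subr0 unitr1.
- by rewrite -opprB unitrN unit_alB1.
- by rewrite subr0 unit_al.
- exact: unit_alB1.
Qed.

Lemma difference_linear_array : difference_matrix (linear_array a alpha).
Proof.
split=> [i g|i|g neg|g g' neg].
- by rewrite linear_arrayE.
- by rewrite linear_arrayE mul0r.
- have u_unit := unit_multiplierB neg; rewrite [multiplier ord0]/(0 : Za) subr0 in u_unit.
  rewrite /image_mem; under eq_map => i do rewrite linear_arrayE.
  apply: uniq_perm; rewrite ?iota_uniq //; last exact: mem_unit_multiples.
  by rewrite map_inj_uniq ?enum_uniq // => i i' /val_inj/(mulrI u_unit).
move=> z; pose u := multiplier g - multiplier g'.
have -> : [seq (((linear_array a alpha i g)%:Z - (linear_array a alpha i g')%:Z) %% a)%Z | i : Za]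
    = map Posz [seq val (u * i) | i : Za].
  rewrite /image_mem -map_comp; apply: eq_map => i.
  by rewrite [LHS]modz_Zp mulrzBr !linear_arrayE -!pmulrn !natr_Zp -mulrBl.
apply/mapP/mapP => -[k mk ->]; exists k => //.
  by rewrite -(mem_unit_multiples (unit_multiplierB neg)).
by rewrite (mem_unit_multiples (unit_multiplierB neg)).
Qed.

(** * Minimum distance *)

Lemma F2_neq0 (b : 'F_2) : b != 0 -> b = 1.
Proof. by case: b => [[|[|b]] ltb] // _; apply: val_inj. Qed.

Lemma natr_F2_eq0 n : (n%:R == 0 :> 'F_2) = ~~ odd n.
Proof. by rewrite -(@Fp_nat_mod 2) // modn2; case: (odd n). Qed.

Lemma even_codeword x : x \in code H ->
  forall k, even_fibres [set j | x j ord0 != 0] (line k).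
Proof.
rewrite mem_code => /eqP Hx k p _; rewrite -natr_F2_eq0 -sumr_const; apply/eqP.
transitivity ((H *m x) (blk k (line k p)) ord0); last by rewrite Hx mxE.
rewrite [RHS]mxE [RHS](bigID [pred j in fibre [set j | x j ord0 != 0] (line k) p]) /=.
rewrite [X in _ = _ + X]big1 ?addr0 => [|j].
  apply: eq_bigr => j; rewrite !inE => /andP[/F2_neq0-> /eqP e].
  by rewrite HE blk1K blk2K e eqxx mulr1.
rewrite !inE negb_and negbK HE blk1K blk2K.
by case/orP=> [/eqP->|/negPf->]; rewrite ?mulr0 ?mul0r.
Qed.

Lemma weight_ge10 x : x \in code H -> x != 0 -> (10 <= hamming_weight x)%N.
Proof.
move=> xH x0; have ev := even_codeword xH.
apply: (@even_set_card_ge10 _ Za _ xcoord ycoord).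
- by split; [apply: unit2 | apply: unit3 | apply: unit5].
- by move=> j j' _ _; apply: coord_inj.
- exact: (ev (@Ordinal 4 0 isT)).
- exact: (ev (@Ordinal 4 1 isT)).
- exact: (ev (@Ordinal 4 2 isT)).
- have unitN2 : (- 2 : Za) \is a GRing.unit by rewrite unitrN unit2.
  apply: (even_fibres_scale unitN2 _ (ev (@Ordinal 4 3 isT))) => j.
  rewrite /line /= mulrDr mulrA mulNr double_al; ring.
apply: contraNneq x0 => S0; apply/eqP/colP=> j; rewrite [RHS]mxE.
by have := in_set0 j; rewrite -S0 inE => /negbFE/eqP.
Qed.

(** The support of a codeword of weight 10: in each of the four classes its points
    lie two by two on five lines. *)
Definition word10 : seq (nat * nat) :=
  [:: (0, 1); (0, 3); (1, 0); (1, 3); (2, 2); (2, 4); (3, 0); (3, 4); (5, 1); (5, 2)]%N.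

(** Integer coordinates of the lines through a point, with [x - 2 * y] for the last
    class: in integers the evenness is a computation, valid for all [a]. *)
Definition word_line (k : nat) (p : nat * nat) : int :=
  match k with
  | 0 => p.1%:Z
  | 1 => p.2%:Z
  | 2 => p.1%:Z + p.2%:Z
  | _ => p.1%:Z - (2 * p.2)%N%:Z
  end.

Lemma word_line_even k : (k < 4)%N ->
  let s := map (word_line k) word10 in perm_eq s (undup s ++ undup s).
Proof. by case: k => [|[|[|[|k]]]]. Qed.

Definition point (p : nat * nat) : 'I_cols := blk (p.1%:R : Za) (p.2%:R : Za).

Lemma line_point k p :
  line k (point p) = (if val k == 3 then al else 1) * (word_line (val k) p)%:~R.
Proof.
rewrite /line /xcoord /ycoord !blk1K !blk2K.
case: k => [[|[|[|[|k]]]] ltk] //; rewrite ?mul1r //.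
- by rewrite mulrzDr.
rewrite -[LHS]/(al * p.1%:R + p.2%:R) -[RHS]/(al * (p.1%:Z - (2 * p.2)%N%:Z)%:~R).
rewrite mulrzBr -!pmulrn natrM mulrBr mulrA [al * 2%:R]mulrC double_al; ring.
Qed.

Lemma word_in_code (x : 'cV['F_2]_cols) :
    (forall j, x j ord0 = (j \in map point word10)%:R) -> uniq (map point word10) ->
  x \in code H.
Proof.
move=> xE us; rewrite mem_code; apply/eqP/colP=> i; rewrite mxE [RHS]mxE.
transitivity (\sum_(p <- word10) H i (point p)).
  rewrite -(big_map point xpredT (H i)) [RHS]big_uniq // [RHS]big_mkcond.
  by apply: eq_bigr => j _; rewrite xE; case: (_ \in _); rewrite ?mulr1 ?mulr0.
set k := blk1 i.
pose F z : 'F_2 := ((if val k == 3%N then al else 1) * z%:~R == blk2 i)%:R.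
rewrite (eq_bigr (fun p => F (word_line k p))); last by move=> p _; rewrite HE line_point.
rewrite -(big_map (word_line k) xpredT F) (perm_big _ (word_line_even (ltn_ord k))) big_cat.
by rewrite /= addrr_pchar2 // pchar_Fp.
Qed.

Hypothesis a_ge7 : (7 <= a)%N.

(** The coordinates of the ten points are below 7. *)
Lemma uniq_word : uniq (map point word10).
Proof.
rewrite map_inj_in_uniq // => p q ps qs /blk_inj[].
have small r : r \in word10 -> (r.1 < a)%N && (r.2 < a)%N.
  move=> rs; have : all (fun r => (r.1 < 7) && (r.2 < 7))%N word10 by [].
  by move/allP/(_ r rs)/andP=> [r1 r2]; rewrite !(leq_trans _ a_ge7).
move=> /(congr1 (@nat_of_ord _)) + /(congr1 (@nat_of_ord _)).
have [/andP[p1 p2] /andP[q1 q2]] := (small p ps, small q qs).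
rewrite !(@val_Zp_nat a) // !modn_small //.
by case: p q {ps qs p1 p2 q1 q2} => [p1 p2] [q1 q2] /= -> ->.
Qed.

Lemma exists_weight10 : exists x, [/\ x \in code H, x != 0 & hamming_weight x = 10%N].
Proof.
pose x : 'cV['F_2]_cols := \col_j (j \in map point word10)%:R.
have xE j : x j ord0 = (j \in map point word10)%:R by rewrite mxE.
have wx : hamming_weight x = 10%N.
  rewrite -[10%N]/(size (map point word10)) -(card_uniqP uniq_word) /hamming_weight cardsE.
  by apply: eq_card => j; rewrite -topredE /= xE; case: (j \in _).
exists x; split=> //.
  exact: word_in_code uniq_word.
apply/eqP=> x0; move: wx; rewrite x0 /hamming_weight.
suff -> : [set i | (0 : 'cV['F_2]_cols) i ord0 != 0] = set0 by rewrite cards0.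
by apply/setP=> j; rewrite !inE mxE eqxx.
Qed.

End Code.

Theorem theorem14 (a : nat) (a_ge3 : (3 <= a)%N) (a_odd : odd a)
    (a_gcd3 : gcdn a 3 = 1%N) (a_gcd5 : gcdn a 5 = 1%N) :
  let alpha := ((a - 1) %/ 2)%N in
  let D := linear_array a alpha in
  let H := construction1 D in
  difference_matrix D /\
  [/\ regular_mx H (a ^ 2) 4 a /\ @quasi_cyclic _ 4 a a H,
      code_length H = (a ^ 2)%N,
      girth_at_least (tanner H) 6,
      rate H = 1 - (4 * a%:R - 3) / a%:R ^+ 2
    & min_distance H 10].
Proof.
case: a a_ge3 a_odd a_gcd3 a_gcd5 => [|[|N]] // a_ge3 a_odd a_gcd3 a_gcd5 alpha D H.
have alphaE : alpha = ((N.+2 - 1) %/ 2)%N by [].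
(* 3 and 5 are excluded by the divisibility hypotheses. *)
have a_ge7 : (7 <= N.+2)%N.
  by case: N a_ge3 a_odd a_gcd3 a_gcd5 {alpha D H alphaE} => [|[|[|[|[|N]]]]].
split; first exact: difference_linear_array.
split.
- by split; [apply: regular | apply: quasi_cyclic_H].
- exact: length_code.
- exact: girth6.
- exact: rate_H.
split; first exact: exists_weight10.
by move=> x; apply: weight_ge10.
Qed.
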